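(* Assume $f_1,\dots,f_m$ are strongly convex ($\mu>0$, $M>0$) and the prox-functions satisfy the quadratic growth condition with constant $\mathcal{C}$. Let $\mathbf{x}^*$ be an optimal solution of (P), and let $\mathbf{y}^*$ be such that $(\mathbf{x}^*,\mathbf{y}^* )$ is a saddle point of (SP). Let $N\ge2$, $\tilde D>0$, and run the DCS method with $$\lambda_t=t,\qquad \beta_t^{(k)}=\frac{(t+1)\mu}{2\eta_k\mathcal{C}}+\frac{t-1}{2},\qquad t\ge1,$$ and, for $k=1,\dots,N$, $$\alpha_k=\frac{k}{k+1},\quad\theta_k=k+1,\quad\eta_k=\frac{k\mu}{2\mathcal{C}},\quad\tau_k=\frac{4\|\mathbf{L}\|^2\mathcal{C}}{(k+1)\mu},\quad T_k=\left\lceil\sqrt{\frac{2m}{\tilde D}}\,\frac{\mathcal{C}MN}{\mu}\max\left\{\sqrt{\frac{2m}{\tilde D}}\,\frac{4\mathcal{C}M}{\mu},1\right\}\right\rceil.$$ Then $\hat{\mathbf{x}}^N_{\mathrm{avg}}:=\frac{2}{N(N+3)}\sum_{k=1}^N(k+1)\hat{\mathbf{x}}^k$ satisfies $$F(\hat{\mathbf{x}}^N_{\mathrm{avg}})-F(\mathbf{x}^* )\le\frac{2}{N(N+3)}\left[\frac{\mu}{\mathcal{C}}\mathbf{V}(\mathbf{x}^0,\mathbf{x}^* )+\frac{2\|\mathbf{L}\|^2\mathcal{C}}{\mu}\|\mathbf{y}^0\|^2+\frac{2\mu\tilde D}{\mathcal{C}}\right]$$ and $$\|\mathbf{L}\hat{\mathbf{x}}^N_{\mathrm{avg}}\|\le\frac{8\|\mathbf{L}\|}{N(N+3)}\left[3\sqrt{2\tilde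 D+\mathbf{V}(\mathbf{x}^0,\mathbf{x}^* )}+\frac{7\|\mathbf{L}\|\mathcal{C}}{\mu}\|\mathbf{y}^*-\mathbf{y}^0\|\right].$$
   Context: Setting. Let $m\ge 2$, $d\ge 1$, and let $\mathcal{G}=([m],\mathcal{E})$ be a connected undirected graph. Put $N_i=\{j:(i,j)\in\mathcal{E}\}\cup\{i\}$. The Laplacian $L\in\mathbb{R}^{m\times m}$ has $L_{ii}=|N_i|-1$, $L_{ij}=-1$ if $i\ne j$ and $(i,j)\in\mathcal{E}$, and $L_{ij}=0$ otherwise; $\mathbf{L}=L\otimes I_d$. For each $i\in[m]$, $X_i\subseteq\mathbb{R}^d$ is closed convex and $\bigcap_i X_i\neq\emptyset$; $\|\cdot\|_{X_i}$ is a norm on $\mathbb{R}^d$; $f_i:X_i\to\mathbb{R}$ is convex, with subgradients $f_i'(y)\in\partial f_i(y)$ satisfying $\frac{\mu}{2}\|x-y\|_{X_i}^2\le f_i(x)-f_i(y)-\langle f_i'(y),x-y\rangle\le M\|x-y\|_{X_i}$ for all $x,y\in X_i$. Prox-functions. $\omega_i:X_i\to\mathbb{R}$ is continuously differentiable with $\langle\nabla\omega_i(x)-\nabla\omega_i(u),x-u\rangle\ge\|x-u\|_{X_i}^2$, and $V_i(x,u)=\omega_i(u)-\omega_i(x)-\langle\nabla\omega_i(x),u-x\rangle$. Quadratic growth condition with constant $\mathcal{C}>0$: $V_i(x_i,u_i)\le\frac{\mathcal{C}}{2}\|x_i-u_i\|_{X_i}^2$ for all $x_i,u_i\in X_i$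 and all $i$. Write $X^m=X_1\times\dots\times X_m$, $\mathbf{x}=(x_1,\dots,x_m)$, $\|\mathbf{x}\|^2=\sum_i\|x_i\|_{X_i}^2$ for primal vectors, $\mathbf{V}(\mathbf{x},\mathbf{u})=\sum_iV_i(x_i,u_i)$. Dual vectors $\mathbf{y}\in\mathbb{R}^{md}$ and vectors $\mathbf{L}\mathbf{x}$ are measured in the Euclidean norm, and $\|\mathbf{L}\|$ is the operator norm from the primal norm to the Euclidean norm. Problem. (P): minimize $F(\mathbf{x})=\sum_{i=1}^mf_i(x_i)$ subject to $\mathbf{L}\mathbf{x}=\mathbf{0}$, $\mathbf{x}\in X^m$. (SP): $\min_{\mathbf{x}\in X^m}\big[F(\mathbf{x})+\max_{\mathbf{y}\in\mathbb{R}^{md}}\langle\mathbf{L}\mathbf{x},\mathbf{y}\rangle\big]$. It is assumed that there are an optimal solution $\mathbf{x}^*$ of (P) and $\mathbf{y}^*\in\mathbb{R}^{md}$ such that $(\mathbf{x}^*,\mathbf{y}^* )$ is a saddle point of (SP). DCS method. Given $\mathbf{x}^0=\mathbf{x}^{-1}=\hat{\mathbf{x}}^0\in X^m$, $\mathbf{y}^0\in\mathbb{R}^{md}$, parameters $\alpha_k,\tau_k,\eta_k$, positive integers $T_k$, and inner parameters $\lambda_t,\beta_t^{(k)}$ (the $\theta_k$ are averaging weights), for $k=1,\dots,N$ set $\tilde{\mathbf{x}}^k=\alpha_k(\hat{\mathbf{x}}^{k-1}-\mathbf{x}^{k-2})+\mathbf{x}^{k-1}$; $\mathbf{y}^k=\mathbf{y}^{k-1}+\frac1{\tau_k}\mathbf{L}\tilde{\mathbf{x}}^k$;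 $\mathbf{w}^k=(w_1^k,\dots,w_m^k)=\mathbf{L}\mathbf{y}^k$; and for each $i\in[m]$: $u_i^{0,k}=x_i^{k-1}$; for $t=1,\dots,T_k$, $h_i^{t-1,k}=f_i'(u_i^{t-1,k})$ and $u_i^{t,k}=\arg\min_{u\in X_i}\big[\langle w_i^k+h_i^{t-1,k},u\rangle+\eta_kV_i(x_i^{k-1},u)+\eta_k\beta_t^{(k)}V_i(u_i^{t-1,k},u)\big]$; then $x_i^k=u_i^{T_k,k}$ and $\hat x_i^k=\big(\sum_{t=1}^{T_k}\lambda_t\big)^{-1}\sum_{t=1}^{T_k}\lambda_tu_i^{t,k}$. *)

(* Defs.v *)
From HB Require Import structures.
From mathcomp Require Import all_boot all_order all_algebra.
From mathcomp Require Import all_classical all_reals all_analysis.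
From mathcomp Require Import mxtens.

Set Implicit Arguments.
Unset Strict Implicit.
Unset Printing Implicit Defensive.

Import Order.TTheory GRing.Theory Num.Theory.
Import numFieldNormedType.Exports.

Local Open Scope classical_set_scope.
Local Open Scope ring_scope.

(* A stacked vector (v_1, ..., v_m) of R^(md) is represented by the matrix
   v : 'M_(m, d) with [row i v] = v_i; a vector of R^d is a 'rV_d. *)

(* For m = 1 this is the inner product of R^d, in general that of R^(md). *)
Definition dotp (R : realType) (m d : nat) (a b : 'M[R]_(m, d)) : R :=
  \sum_(i < m) \sum_(j < d) a i j * b i j.

Definition enorm (R : realType) (m d : nat) (a : 'M[R]_(m, d)) : R :=
  Num.sqrt (dotp a a).

Record is_norm (R : realType) (V : lmodType R) (nu : V -> R) : Prop := IsNorm {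
  is_norm_triangle : forall x y, nu (x + y) <= nu x + nu y;
  is_norm_homogeneous : forall (a : R) x, nu (a *: x) = `|a| * nu x;
  is_norm_ge0 : forall x, 0 <= nu x;
  is_norm_definite : forall x, nu x = 0 -> x = 0 }.

Definition opnorm (R : realType) (V W : lmodType R)
    (nuV : V -> R) (nuW : W -> R) (A : V -> W) : R :=
  sup [set nuW (A x) | x in [set x | nuV x <= 1]].

Definition argmin (R : realType) (T : Type) (A : set T) (J : T -> R) : set T :=
  [set u | A u /\ forall v, A v -> J u <= J v].

Definition subdifferential (R : realType) (d : nat) (X : set 'rV[R]_d)
    (f : 'rV[R]_d -> R) (y : 'rV[R]_d) : set 'rV[R]_d :=
  [set g | forall x, X x -> f y + dotp g (x - y) <= f x].

Definition nbhd (m : nat) (e : rel 'I_m) (i : 'I_m) : {set 'I_m} :=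
  ([set j | e i j] :|: [set i])%SET.

Definition laplacian (R : realType) (m : nat) (e : rel 'I_m) : 'M[R]_m :=
  \matrix_(i, j) (if i == j then #|nbhd e i|%:R - 1
                  else if e i j then -1 else 0).

Definition stack (R : realType) (m d : nat) (x : 'M[R]_(m, d)) :
    'cV[R]_(m * d) :=
  \col_k x (mxtens_unindex k).1 (mxtens_unindex k).2.

Definition unstack (R : realType) (m d : nat) (v : 'cV[R]_(m * d)) :
    'M[R]_(m, d) :=
  \matrix_(i, j) v (mxtens_index (i, j)) 0.

Definition boldL (R : realType) (m d : nat) (e : rel 'I_m)
    (x : 'M[R]_(m, d)) : 'M[R]_(m, d) :=
  unstack ((laplacian R e *t (1%:M : 'M[R]_d)) *m stack x).

Lemma boldLE (R : realType) (m d : nat) (e : rel 'I_m) (x : 'M[R]_(m, d)) :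
  boldL e x = laplacian R e *m x.
Proof.
apply/matrixP => i j; rewrite [LHS]mxE [LHS]mxE [RHS]mxE.
rewrite (reindex (@mxtens_index m d)) /=; last first.
  by exists (@mxtens_unindex m d) => k _;
    [exact: mxtens_indexK | exact: mxtens_unindexK].
pose G k l : R := laplacian R e i k * (1%:M : 'M[R]_d) j l * x k l.
rewrite (eq_bigr (fun p => G p.1 p.2)); last first.
  by case=> k l _; rewrite tensmxE [stack _ _ _]mxE mxtens_indexK.
rewrite -(pair_bigA _ G) /=; apply: eq_bigr => k _.
rewrite (bigD1 j) //= big1 ?addr0.
  by rewrite /G [X in _ * X * _]mxE eqxx mulr1.
move=> l ne_lj.
by rewrite /G [X in _ * X * _]mxE eq_sym (negbTE ne_lj) mulr0 mul0r.
Qed.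

(* omega is only meant on X, whose interior may be empty; its gradient is
   therefore the datum [gomega], with differentiability taken relatively to X. *)
Record prox_function (R : realType) (d : nat) (X : set 'rV[R]_d)
    (nu : 'rV[R]_d -> R) (omega : 'rV[R]_d -> R)
    (gomega : 'rV[R]_d -> 'rV[R]_d) : Prop := ProxFunction {
  prox_differentiable : forall x, X x -> let F := within X (nbhs x) in
    (fun u => (omega u - omega x - dotp (gomega x) (u - x)) : R^o)
      =o_F (fun u => u - x);
  prox_continuous : {within X, continuous gomega};
  prox_strongly_convex : forall x u, X x -> X u ->
    nu (x - u) ^+ 2 <= dotp (gomega x - gomega u) (x - u) }.

Definition bregman (R : realType) (d : nat) (omega : 'rV[R]_d -> R)
    (gomega : 'rV[R]_d -> 'rV[R]_d) (x u : 'rV[R]_d) : R :=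
  omega u - omega x - dotp (gomega x) (u - x).

Definition prodset (R : realType) (m d : nat) (X : 'I_m -> set 'rV[R]_d) :
    set 'M[R]_(m, d) :=
  [set x | forall i, X i (row i x)].

Definition pnorm (R : realType) (m d : nat) (nu : 'I_m -> 'rV[R]_d -> R)
    (x : 'M[R]_(m, d)) : R :=
  Num.sqrt (\sum_(i < m) nu i (row i x) ^+ 2).

Definition normL (R : realType) (m d : nat) (nu : 'I_m -> 'rV[R]_d -> R)
    (e : rel 'I_m) : R :=
  opnorm (pnorm nu) (@enorm R m d) (boldL e).

Definition sum_bregman (R : realType) (m d : nat)
    (omega : 'I_m -> 'rV[R]_d -> R) (gomega : 'I_m -> 'rV[R]_d -> 'rV[R]_d)
    (x u : 'M[R]_(m, d)) : R :=
  \sum_(i < m) bregman (omega i) (gomega i) (row i x) (row i u).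

Definition objective (R : realType) (m d : nat) (f : 'I_m -> 'rV[R]_d -> R)
    (x : 'M[R]_(m, d)) : R :=
  \sum_(i < m) f i (row i x).

Definition optimal_solution (R : realType) (m d : nat) (e : rel 'I_m)
    (X : 'I_m -> set 'rV[R]_d) (f : 'I_m -> 'rV[R]_d -> R)
    (xs : 'M[R]_(m, d)) : Prop :=
  argmin [set x | boldL e x = 0 /\ prodset X x] (objective f) xs.

Definition lagrangian (R : realType) (m d : nat) (e : rel 'I_m)
    (f : 'I_m -> 'rV[R]_d -> R) (x y : 'M[R]_(m, d)) : R :=
  objective f x + dotp (boldL e x) y.

Definition saddle_point (R : realType) (m d : nat) (e : rel 'I_m)
    (X : 'I_m -> set 'rV[R]_d) (f : 'I_m -> 'rV[R]_d -> R)
    (xs ys : 'M[R]_(m, d)) : Prop :=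
  prodset X xs /\
  forall x y : 'M[R]_(m, d), prodset X x ->
    lagrangian e f xs y <= lagrangian e f xs ys <= lagrangian e f x ys.

(* N outer iterations; [u k t] has rows u_i^(t,k), and [f'] is the selection of
   subgradients. *)
Record dcs_run (R : realType) (m d : nat) (e : rel 'I_m)
    (X : 'I_m -> set 'rV[R]_d) (f' : 'I_m -> 'rV[R]_d -> 'rV[R]_d)
    (V : 'I_m -> 'rV[R]_d -> 'rV[R]_d -> R) (N : nat)
    (alpha tau eta : nat -> R) (T : nat -> nat)
    (lambda : nat -> R) (beta : nat -> nat -> R)
    (x xhat xtilde y w : nat -> 'M[R]_(m, d))
    (u : nat -> nat -> 'M[R]_(m, d)) : Prop := DcsRun {
  dcs_init : prodset X (x 0%N) /\ xhat 0%N = x 0%N;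
  (* The truncated [k - 2] encodes x^(-1) = x^0 at k = 1. *)
  dcs_xtilde : forall k, (1 <= k <= N)%N ->
    xtilde k = alpha k *: (xhat (k - 1)%N - x (k - 2)%N) + x (k - 1)%N;
  dcs_y : forall k, (1 <= k <= N)%N ->
    y k = y (k - 1)%N + (tau k)^-1 *: boldL e (xtilde k);
  dcs_w : forall k, (1 <= k <= N)%N -> w k = boldL e (y k);
  dcs_u0 : forall k, (1 <= k <= N)%N -> u k 0%N = x (k - 1)%N;
  dcs_u : forall k t i, (1 <= k <= N)%N -> (1 <= t <= T k)%N ->
    argmin (X i)
      (fun v => dotp (row i (w k) + f' i (row i (u k (t - 1)%N))) v
                + eta k * V i (row i (x (k - 1)%N)) v
                + eta k * beta k t * V i (row i (u k (t - 1)%N)) v)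
      (row i (u k t));
  dcs_x : forall k, (1 <= k <= N)%N -> x k = u k (T k);
  dcs_xhat : forall k, (1 <= k <= N)%N ->
    xhat k = (\sum_(1 <= t < (T k).+1) lambda t)^-1 *:
             \sum_(1 <= t < (T k).+1) lambda t *: u k t }.

(* Main.v *)
(** Inner loop: each prox step satisfies a three-point inequality; weighted by
    t, the choice of [beta] makes the coefficients of V(u_t, v) telescope
    exactly, so agent i gains (mu/C + eta_k) V_i(x_i^k, v) up to an error of
    order M^2 / (T eta_k) + M^2 C / (mu T^2).

    Outer loop: with delta_k = xhat^k - x^(k-1), the extrapolation gives
    (k+1) L xtilde^k = (k+1) L xhat^k - (k+1) L delta_k + k L delta_(k-1).
    The weighted gaps at (z, y) therefore telescope, the remaining cross terms
    k <L delta_(k-1), y^k - y^(k-1)> being absorbed by the squares of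
    delta_(k-1) and y^k - y^(k-1), since k <= 2 (k - 1) for k >= 2.  The
    objective bound is the gap at (xs, 0).

    Infeasibility: the same telescoping gives the exact identity
    sum_k (k+1) L xhat^k = c (y^N - y^0) + (N+1) L delta_N with
    c = 4 |L|^2 C / mu.  As the gap at (xs, ys) is nonnegative, it bounds a
    quadratic form in |y^N - ys| and |delta_N| which is positive definite for
    N >= 2, and this controls both terms of the identity. *)

Require Import Defs.
From mathcomp Require Import all_boot all_order all_algebra.
From mathcomp Require Import all_classical all_reals all_analysis.
From mathcomp Require Import ring lra.

Set Implicit Arguments.
Unset Strict Implicit.
Unset Printing Implicit Defensive.

Import Order.TTheory GRing.Theory Num.Theory.
Import numFieldNormedType.Exports.

Local Open Scope classical_set_scope.
Local Open Scope ring_scope.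

(** * Inner product, Laplacian and convex averages *)

Section InnerProduct.
Variables (R : realType) (m d : nat).
Implicit Types (a b c : 'M[R]_(m, d)) (k : R).

Lemma dotpC a b : dotp a b = dotp b a.
Proof. by apply: eq_bigr => i _; apply: eq_bigr => j _; rewrite mulrC. Qed.

Lemma dotpDl a b c : dotp (a + b) c = dotp a c + dotp b c.
Proof.
rewrite /dotp -big_split; apply: eq_bigr => i _ /=.
by rewrite -big_split; apply: eq_bigr => j _; rewrite mxE mulrDl.
Qed.

Lemma dotpZl k a c : dotp (k *: a) c = k * dotp a c.
Proof.
rewrite /dotp mulr_sumr; apply: eq_bigr => i _.
by rewrite mulr_sumr; apply: eq_bigr => j _; rewrite mxE mulrA.
Qed.

Lemma dotpNl a c : dotp (- a) c = - dotp a c.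
Proof. by rewrite -scaleN1r dotpZl mulN1r. Qed.

Lemma dotp0l c : dotp 0 c = 0 :> R.
Proof. by rewrite -(scale0r 0) dotpZl mul0r. Qed.

Lemma dotpDr a b c : dotp c (a + b) = dotp c a + dotp c b.
Proof. by rewrite dotpC dotpDl !(dotpC c). Qed.

Lemma dotpZr k a c : dotp c (k *: a) = k * dotp c a.
Proof. by rewrite dotpC dotpZl (dotpC c). Qed.

Lemma dotpNr a c : dotp c (- a) = - dotp c a.
Proof. by rewrite dotpC dotpNl (dotpC c). Qed.

Lemma dotp0r c : dotp c 0 = 0 :> R.
Proof. by rewrite dotpC dotp0l. Qed.

Definition dotpE :=
  (dotpDl, dotpDr, dotpNl, dotpNr, dotpZl, dotpZr, dotp0l, dotp0r).

Lemma dotp_sumr (I : Type) (r : seq I) (P : pred I) (F : I -> 'M[R]_(m, d)) c :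
  dotp c (\sum_(i <- r | P i) F i) = \sum_(i <- r | P i) dotp c (F i).
Proof. by apply: (big_morph (dotp c)) => [a b|]; rewrite !dotpE. Qed.

Lemma dotp_rows a b : dotp a b = \sum_(i < m) dotp (row i a) (row i b).
Proof.
apply: eq_bigr => i _; rewrite /dotp big_ord1.
by apply: eq_bigr => j _; rewrite !mxE.
Qed.

Lemma dotp_ge0 a : 0 <= dotp a a.
Proof. by do 2! [apply: sumr_ge0 => ? _]; rewrite -expr2 sqr_ge0. Qed.

Lemma enorm_ge0 a : 0 <= enorm a.
Proof. exact: sqrtr_ge0. Qed.

Lemma sqr_enorm a : enorm a ^+ 2 = dotp a a.
Proof. by rewrite sqr_sqrtr ?dotp_ge0. Qed.

Lemma enorm_eq0 a : enorm a = 0 -> a = 0.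
Proof.
move/(congr1 (fun z => z ^+ 2)); rewrite sqr_enorm expr0n /= => /eqP.
rewrite psumr_eq0 => [/allP a0|i _]; last first.
  by apply: sumr_ge0 => j _; rewrite -expr2 sqr_ge0.
apply/matrixP => i j; rewrite mxE.
have /implyP/(_ isT) := a0 i (mem_index_enum i).
rewrite psumr_eq0 => [/allP/(_ j (mem_index_enum j))|? _]; last first.
  by rewrite -expr2 sqr_ge0.
by rewrite /= -expr2 sqrf_eq0 => /eqP.
Qed.

Lemma enormZ k a : enorm (k *: a) = `|k| * enorm a.
Proof.
by rewrite /enorm !dotpE mulrA -expr2 sqrtrM ?sqr_ge0 // sqrtr_sqr.
Qed.

(** Cauchy-Schwarz: for nonzero a and b, the squared norm of |b| a - |a| b expands to 2 |a| |b| (|a|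
    |b| - <a, b>). *)
Lemma dotp_le_enorm a b : dotp a b <= enorm a * enorm b.
Proof.
have [/enorm_eq0 ->|b0] := eqVneq (enorm b) 0.
  by rewrite dotp0r mulr_ge0 ?enorm_ge0.
have b_gt0 : 0 < enorm b by rewrite lt_neqAle eq_sym b0 enorm_ge0.
have := dotp_ge0 (enorm b *: a - enorm a *: b).
rewrite !dotpE -!sqr_enorm (dotpC b a) => h.
have [/enorm_eq0 ->|a0] := eqVneq (enorm a) 0.
  by rewrite dotp0l mulr_ge0 ?enorm_ge0.
have a_gt0 : 0 < enorm a by rewrite lt_neqAle eq_sym a0 enorm_ge0.
rewrite -subr_ge0 -(pmulr_rge0 _ (mulr_gt0 a_gt0 b_gt0)).
by nra.
Qed.

Lemma enormD a b : enorm (a + b) <= enorm a + enorm b.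
Proof.
rewrite -(@ler_pXn2r _ 2) ?nnegrE ?addr_ge0 ?enorm_ge0 //.
rewrite sqr_enorm !dotpE -!sqr_enorm (dotpC b a).
by have := dotp_le_enorm a b; nra.
Qed.

Lemma enorm_sum (I : Type) (r : seq I) (P : pred I) (F : I -> 'M[R]_(m, d)) :
  enorm (\sum_(i <- r | P i) F i) <= \sum_(i <- r | P i) enorm (F i).
Proof.
apply: (big_ind2 (fun x y => enorm x <= y)) => //.
  by rewrite /enorm dotp0l sqrtr0.
move=> x1 x2 y1 y2 h1 h2; apply: le_trans (enormD _ _) _; exact: lerD.
Qed.

Lemma enormN a : enorm (- a) = enorm a.
Proof. by rewrite -scaleN1r enormZ normrN1 mul1r. Qed.

End InnerProduct.

Section Laplacian.
Variables (R : realType) (m d : nat) (e : rel 'I_m).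
Implicit Types (a b : 'M[R]_(m, d)).

Lemma boldLD a b : boldL e (a + b) = boldL e a + boldL e b.
Proof. by rewrite !boldLE mulmxDr. Qed.

Lemma boldLZ (k : R) a : boldL e (k *: a) = k *: boldL e a.
Proof. by rewrite !boldLE -scalemxAr. Qed.

Lemma boldLN a : boldL e (- a) = - boldL e a.
Proof. by rewrite !boldLE mulmxN. Qed.

Lemma boldL0 : boldL e 0 = 0 :> 'M[R]_(m, d).
Proof. by rewrite boldLE mulmx0. Qed.

Lemma boldL_sum (I : Type) (r : seq I) (P : pred I) (F : I -> 'M[R]_(m, d)) :
  boldL e (\sum_(i <- r | P i) F i) = \sum_(i <- r | P i) boldL e (F i).
Proof. exact: (big_morph _ boldLD boldL0). Qed.

Hypothesis e_sym : symmetric e.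

Lemma laplacian_sym i j : laplacian R e i j = laplacian R e j i.
Proof. by rewrite !mxE e_sym; case: eqVneq => [->|]. Qed.

(** Self-adjointness comes from the symmetry of the graph; it turns <w^k, z>, with w^k = L y^k, into
    <L z, y^k>. *)
Lemma dotp_boldL a b : dotp (boldL e a) b = dotp a (boldL e b).
Proof.
transitivity (\sum_i \sum_k \sum_j laplacian R e i k * a k j * b i j).
  apply: eq_bigr => i _; rewrite exchange_big /=; apply: eq_bigr => j _.
  by rewrite boldLE mxE mulr_suml.
rewrite exchange_big /=; apply: eq_bigr => k _.
rewrite exchange_big /=; apply: eq_bigr => j _.
rewrite boldLE mxE mulr_sumr; apply: eq_bigr => i _.
by rewrite laplacian_sym mulrCA mulrA.
Qed.

End Laplacian.

Section ConvexAverage.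
Variables (R : realType) (V : lmodType R) (A : set V).
Hypothesis A_convex : convex_set (A : set (convex_lmodType V)).

Lemma convex_set_comb (p q : V) (s : R) :
  A p -> A q -> 0 <= s -> s <= 1 -> A (p + s *: (q - p)).
Proof.
move=> Ap Aq s0 s1.
have /= := A_convex (Itv01 s0 s1) (mem_set Aq) (mem_set Ap).
rewrite inE [conv _ _ _]/(s *: q + (1 - s) *: p).
by congr (A _); rewrite scalerBl scale1r scalerBr addrCA.
Qed.

(** Induction on n: appending p_(n+1) moves the previous average towards it by the fraction c_(n+1)
    / (S + c_(n+1)). *)
Lemma convex_set_avg (c : nat -> R) (p : nat -> V) (n : nat) :
  (0 < n)%N -> (forall t, (1 <= t <= n)%N -> 0 < c t) ->
  (forall t, (1 <= t <= n)%N -> A (p t)) ->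
  A ((\sum_(1 <= t < n.+1) c t)^-1 *: \sum_(1 <= t < n.+1) c t *: p t).
Proof.
elim: n => // n IH _ c_gt0 Ap; have [->|n_gt0] := posnP n.
  rewrite !big_nat1 scalerA mulVf ?scale1r ?gt_eqF ?c_gt0 //.
  exact: Ap.
rewrite !(big_nat_recr n.+1) //=.
set S := \sum_(1 <= t < n.+1) c t; set P := \sum_(1 <= t < n.+1) _.
have S_gt0 : 0 < S.
  rewrite /S big_ltn // ltr_wpDr ?c_gt0 // big_nat; apply: sumr_ge0 => t.
  by move=> /andP[t2 tn]; rewrite ltW // c_gt0 // (ltnW t2) ltnW.
have cn : 0 < c n.+1 by rewrite c_gt0 ?ltnSn.
have {IH} := IH n_gt0 _ _; rewrite -/S -/P => IH.
have Sc : 0 < S + c n.+1 by rewrite addr_gt0.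
have -> : (S + c n.+1)^-1 *: (P + c n.+1 *: p n.+1) =
    S^-1 *: P + (c n.+1 / (S + c n.+1)) *: (p n.+1 - S^-1 *: P).
  have P_E : P = S *: (S^-1 *: P) by rewrite scalerA divff ?gt_eqF ?scale1r.
  move: P_E; set Q := S^-1 *: P; clearbody Q => ->.
  rewrite scalerDr !scalerA scalerBr addrCA [LHS]addrC.
  rewrite -[Q in Q - _]scale1r -scalerBl.
  by congr (_ *: _ + _ *: _); field; rewrite gt_eqF.
have q_ge0 : 0 <= c n.+1 / (S + c n.+1) by rewrite divr_ge0 ?ltW.
have q_le1 : c n.+1 / (S + c n.+1) <= 1.
  by rewrite ler_pdivrMr // mul1r lerDr ltW.
apply: convex_set_comb q_ge0 q_le1.
  by apply: IH => t /andP[t1 tn]; [apply: c_gt0|apply: Ap]; rewrite t1 /= ltnW.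
by apply: Ap; rewrite /= ltnSn.
Qed.

End ConvexAverage.

(** * The operator norm of the Laplacian *)

Section NormEquivalence.
Variables (R : realType) (d : nat) (nu : 'rV[R]_d -> R).
Hypothesis nu_norm : is_norm nu.

Lemma is_norm0 : nu 0 = 0.
Proof. by rewrite -(scale0r 0) is_norm_homogeneous // normr0 mul0r. Qed.

Lemma is_normN v : nu (- v) = nu v.
Proof. by rewrite -scaleN1r is_norm_homogeneous // normrN1 mul1r. Qed.

Lemma is_norm_le_mx_norm v :
  nu v <= `|v| * \sum_j nu (delta_mx 0 j : 'rV[R]_d).
Proof.
rewrite {1}(row_sum_delta v) mulr_sumr.
apply: (@le_trans _ _ (\sum_j nu (v 0 j *: (delta_mx 0 j : 'rV[R]_d)))).
  apply: (big_ind2 (fun x y => nu x <= y)); rewrite ?is_norm0 //.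
  move=> x1 x2 y1 y2 h1 h2; apply: le_trans (is_norm_triangle nu_norm _ _) _.
  exact: lerD.
apply: ler_sum => j _; rewrite is_norm_homogeneous // ler_wpM2r //.
  exact: is_norm_ge0.
rewrite [`|v|]mx_normrE; apply/bigmax_geP; right => /=.
by exists (0, j).
Qed.

(** The bound by the sup norm makes [nu] Lipschitz; K + 1 keeps the radius positive when K = 0. *)
Lemma is_norm_continuous : continuous nu.
Proof.
move=> v; apply/(@cvgrPdist_lt _ R^o _ _ (nbhs_filter v)) => eps eps_gt0.
set K := \sum_j nu (delta_mx 0 j : 'rV[R]_d).
have K_ge0 : 0 <= K by apply: sumr_ge0 => j _; exact: is_norm_ge0.
have K1 : 0 < K + 1 by rewrite ltr_wpDl.
apply/nbhs_ballP; exists (eps / (K + 1)) => [|w]; first exact: divr_gt0.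
rewrite -ball_normE /= ltr_pdivlMr // => vw.
have /le_lt_trans : `|nu v - nu w| <= nu (v - w).
  have tri a b : nu a - nu b <= nu (a - b).
    rewrite lerBlDr; have := is_norm_triangle nu_norm (a - b) b.
    by rewrite subrK.
  by rewrite ler_norml tri andbT lerNl opprB -[v - w]opprB is_normN tri.
apply; apply: le_lt_trans (is_norm_le_mx_norm _) _; rewrite -/K.
by apply: le_lt_trans vw; rewrite ler_wpM2l // lerDl.
Qed.

(** On the compact unit sphere of the sup norm, [nu] attains a positive minimum; by homogeneity its
    inverse serves as K. *)
Lemma mx_norm_le_is_norm : exists2 K : R, 0 <= K & forall v, `|v| <= K * nu v.
Proof.
pose S := [set v : 'rV[R]_d | `|v| = 1].
(* An empty sphere occurs when 0 is the only vector. *)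
have [[v0 Sv0]|S0] := pselect (S !=set0); last first.
  exists 0 => // v; rewrite mul0r; have [->|v_neq0] := eqVneq v 0.
    by rewrite normr0.
  case: S0; exists (`|v|^-1 *: v); rewrite /S /= normrZ normfV normr_id.
  by rewrite mulVf ?normr_eq0.
have S_compact : compact S.
  apply: bounded_closed_compact.
    by exists 1; split => // x x1 v; rewrite /S /= => ->; exact: ltW.
  by apply: (@closed_comp _ _ (fun v : 'rV[R]_d => `|v|) [set 1]);
    [move=> ? _; exact: norm_continuous | exact: closed_eq].
have [||c Sc c_min] := @EVT_min_rV R d nu S _ S_compact.
- by exists v0.
- by apply: continuous_subspaceT; exact: is_norm_continuous.
move: Sc; rewrite inE /S /= => c1.
have c_gt0 : 0 < nu c.
  rewrite lt_neqAle is_norm_ge0 // andbT eq_sym; apply/eqP => /is_norm_definite.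
  move=> /(_ nu_norm) c0; move: c1; rewrite c0 normr0 => /esym/eqP.
  by rewrite oner_eq0.
exists (nu c)^-1 => [|v]; first by rewrite invr_ge0 ltW.
have [->|v_neq0] := eqVneq v 0; first by rewrite normr0 is_norm0 mulr0.
have v_gt0 : 0 < `|v| by rewrite normr_gt0.
have := c_min (`|v|^-1 *: v); rewrite inE => /(_ _).
rewrite is_norm_homogeneous // normfV normr_id.
rewrite ler_pdivlMl // mulrC => h; rewrite ler_pdivlMl // h //.
by rewrite /S /= normrZ normfV normr_id mulVf ?gt_eqF.
Qed.

End NormEquivalence.

Section OperatorNorm.
Variables (R : realType) (m d : nat) (e : rel 'I_m).
Variable (nu : 'I_m -> 'rV[R]_d -> R).
Hypothesis nu_norm : forall i, is_norm (nu i).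
Implicit Types (x : 'M[R]_(m, d)).

Lemma sqr_pnorm x : pnorm nu x ^+ 2 = \sum_i nu i (row i x) ^+ 2.
Proof. by rewrite sqr_sqrtr // sumr_ge0 // => i _; exact: sqr_ge0. Qed.

Lemma pnorm_ge0 x : 0 <= pnorm nu x.
Proof. exact: sqrtr_ge0. Qed.

Lemma le_pnorm x i : nu i (row i x) <= pnorm nu x.
Proof.
rewrite -(@ler_pXn2r _ 2) ?nnegrE ?pnorm_ge0 ?is_norm_ge0 // sqr_pnorm.
by rewrite (bigD1 i) //= lerDl sumr_ge0 // => j _; exact: sqr_ge0.
Qed.

Lemma pnormZ k x : pnorm nu (k *: x) = `|k| * pnorm nu x.
Proof.
have -> : pnorm nu (k *: x) =
    Num.sqrt (k ^+ 2 * \sum_i nu i (row i x) ^+ 2).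
  congr Num.sqrt; rewrite mulr_sumr; apply: eq_bigr => i _.
  by rewrite linearZ /= is_norm_homogeneous // exprMn real_normK // num_real.
by rewrite sqrtrM ?sqr_ge0 // sqrtr_sqr.
Qed.

(** Boundedness gives [opnorm], a bare [sup], its meaning. Norm equivalence bounds the entries of x
    on the unit ball, hence the expansion of L x over the matrix units. *)
Lemma boldL_bounded : exists K : R,
  forall x, pnorm nu x <= 1 -> enorm (boldL e x) <= K.
Proof.
have /choice[K hK] i : exists K, 0 <= K /\ forall v, `|v| <= K * nu i v.
  by have [K K_ge0 hK] := mx_norm_le_is_norm (nu_norm i); exists K.
exists (\sum_i \sum_j K i * enorm (boldL e (delta_mx i j : 'M[R]_(m, d)))).
move=> x x1.
rewrite {1}(matrix_sum_delta x) boldL_sum.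
apply: le_trans (enorm_sum _ _ _) _; apply: ler_sum => i _.
rewrite boldL_sum; apply: le_trans (enorm_sum _ _ _) _; apply: ler_sum => j _.
rewrite boldLZ enormZ ler_wpM2r ?enorm_ge0 //.
apply: (@le_trans _ _ `|row i x|).
  rewrite [`|row i x|]mx_normrE; apply/bigmax_geP; right => /=.
  by exists (0, j); rewrite //= mxE.
apply: le_trans ((hK i).2 _) _; rewrite ler_piMr ?(hK i).1 //.
exact: le_trans (le_pnorm x i) x1.
Qed.

Let image_bounded :
  has_sup [set enorm (boldL e x) | x in [set x | pnorm nu x <= 1]].
Proof.
have [K hK] := boldL_bounded; split; last by exists K => _ [z z1 <-]; exact: hK.
exists (enorm (boldL e (0 : 'M[R]_(m, d)))), 0 => //=.
by rewrite -(scale0r 0) pnormZ normr0 mul0r.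
Qed.

Lemma normL_ge0 : 0 <= normL nu e.
Proof.
apply: sup_upper_bound => //; exists 0.
  by rewrite /= -(scale0r 0) pnormZ normr0 mul0r.
by rewrite boldL0 /enorm dotp0l sqrtr0.
Qed.

(** Rescale x into the unit ball; if its norm is zero, x itself is zero by definiteness of each
    [nu i]. *)
Lemma enorm_boldL x : enorm (boldL e x) <= normL nu e * pnorm nu x.
Proof.
have [x0|x0] := eqVneq (pnorm nu x) 0.
  have -> : x = 0.
    apply/row_matrixP => i; rewrite row0; apply: (is_norm_definite (nu_norm i)).
    by apply/eqP; rewrite eq_le is_norm_ge0 // andbT -x0 le_pnorm.
  by rewrite boldL0 /enorm dotp0l sqrtr0 mulr_ge0 ?pnorm_ge0 // normL_ge0.
have x_gt0 : 0 < pnorm nu x by rewrite lt_neqAle eq_sym x0 pnorm_ge0.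
rewrite -ler_pdivrMr // mulrC -[_^-1](gtr0_norm _) ?invr_gt0 //.
rewrite -enormZ -boldLZ; apply: sup_upper_bound => //.
exists ((pnorm nu x)^-1 *: x) => //=.
by rewrite pnormZ gtr0_norm ?invr_gt0 // mulVf.
Qed.

End OperatorNorm.

(** * Bregman distances and prox steps *)

Section Bregman.
Variables (R : realType) (d : nat) (X : set 'rV[R]_d) (nu : 'rV[R]_d -> R).
Variables (omega : 'rV[R]_d -> R) (gomega : 'rV[R]_d -> 'rV[R]_d).
Hypothesis X_convex : convex_set (X : set (convex_lmodType 'rV[R]_d)).
Hypothesis nu_norm : is_norm nu.
Hypothesis omega_prox : prox_function X nu omega gomega.
Implicit Types x u v : 'rV[R]_d.

Local Notation V := (bregman omega gomega).

Lemma bregman_three_points x u v :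
  dotp (gomega u - gomega x) (v - u) = V x v - V u v - V x u.
Proof. by rewrite /bregman !dotpE; ring. Qed.

(** V x u is exactly the first-order remainder of [omega] at x, so relative differentiability makes
    it o(|u - x|) within X. *)
Lemma bregman_littleo x (eps : R) : X x -> 0 < eps ->
  exists2 delta : R, 0 < delta &
    forall u, X u -> `|u - x| < delta -> `|V x u| <= eps * `|u - x|.
Proof.
move=> Xx eps_gt0.
have /eqoP/(_ _ eps_gt0) := prox_differentiable omega_prox Xx.
rewrite near_withinE => /nbhs_ballP[delta delta_gt0 h]; exists delta => //.
by move=> u Xu ux; apply: h => //; rewrite -ball_normE /= distrC.
Qed.

(** [omega] along the segment from x to u, followed by its candidate derivative: strong convexity is
    integrated in this single variable. *)
Let line x u (s : R) := omega (x + s *: (u - x)).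
Let dline x u (s : R) := dotp (gomega (x + s *: (u - x))) (u - x).

Let lineP x u (s eps : R) : X x -> X u -> 0 <= s <= 1 -> 0 < eps ->
  exists2 delta : R, 0 < delta &
    forall r : R, 0 <= r <= 1 -> `|r - s| < delta ->
    `|line x u r - line x u s - dline x u s * (r - s)| <= eps * `|r - s|.
Proof.
move=> Xx Xu /andP[s0 s1] eps_gt0.
have k1 : 0 < `|u - x| + 1 by rewrite ltr_wpDl.
have [delta delta_gt0 h] :=
  bregman_littleo (convex_set_comb X_convex Xx Xu s0 s1) (divr_gt0 eps_gt0 k1).
exists (delta / (`|u - x| + 1)) => [|r /andP[r0 r1]]; first exact: divr_gt0.
rewrite ltr_pdivlMr // => rs.
have E : x + r *: (u - x) - (x + s *: (u - x)) = (r - s) *: (u - x).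
  by rewrite opprD addrACA subrr add0r -scalerBl.
have := h _ (convex_set_comb X_convex Xx Xu r0 r1).
rewrite /bregman E dotpZr normrZ (mulrC (r - s)) => /(_ _)/le_trans; apply.
  by apply: le_lt_trans rs; rewrite ler_wpM2l // lerDl.
rewrite (mulrC `|r - s|) mulrA ler_wpM2r // mulrAC.
by rewrite ler_pdivrMr // mulrDr mulr1 lerDl ltW.
Qed.

(** Restricted to interior s: small two-sided increments then stay in the segment, where [omega] is
    controlled. *)
Let is_derive_line x u (s : R) : X x -> X u -> 0 < s -> s < 1 ->
  is_derive s 1 (line x u) (dline x u s).
Proof.
move=> Xx Xu s0 s1.
suff cv : h^-1 *: ((line x u \o shift s) (h *: 1) - line x u s)
    @[h --> (0:R)^'] --> dline x u s.
  by apply: DeriveDef; [apply/cvg_ex; exists (dline x u s)|exact: cvg_lim].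
apply/cvgrPdist_le => eps eps_gt0.
have s01 : 0 <= s <= 1 by rewrite !ltW.
have [delta delta_gt0 hd] := lineP Xx Xu s01 eps_gt0.
have h_small (k : R) : 0 < k -> \forall h \near (0:R)^', `|h| < k.
  by move=> k_gt0; exists k => // z /=; rewrite sub0r normrN.
near=> h.
have h_neq0 : h != 0 by near: h; exact: nbhs_dnbhs_neq.
have hs : `|h| < s by near: h; exact: h_small.
have hs1 : `|h| < 1 - s by near: h; apply: h_small; rewrite subr_gt0.
have hdelta : `|h| < delta by near: h; exact: h_small.
have := hd (h + s); rewrite addrK => /(_ _ hdelta).
move: hs hs1; rewrite !ltr_norml => /andP[hs1 hs2] /andP[hs3 hs4].
have r01 : 0 <= h + s <= 1 by lra.
move=> /(_ r01) hE; rewrite /= [h *: 1]mulr1.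
rewrite -(@ler_pM2r _ `|h|) ?normr_gt0 // -normrM mulrBl.
by rewrite [_ *: _]mulrC divfK // distrC.
Unshelve. all: by end_near. Qed.

(** Endpoints included: the expansion with error |r - s| gives |line r - line s| <= k |r - s| near
    s. *)
Let line_continuous x u : X x -> X u ->
  {within `[0, 1], continuous (line x u : R -> R)}.
Proof.
move=> Xx Xu; apply/subspace_continuousP => s; rewrite /= in_itv /= => s01.
apply/cvgrPdist_le => eps eps_gt0.
have [delta delta_gt0 hd] := lineP Xx Xu s01 ltr01.
pose k := `|dline x u s| + 1; have k_gt0 : 0 < k by rewrite ltr_wpDl.
rewrite near_withinE; apply/nbhs_ballP.
exists (Num.min delta (eps / k)) => [|r].
  by rewrite /= lt_min delta_gt0 divr_gt0.
rewrite -ball_normE /= lt_min distrC => /andP[r1 r2]; rewrite in_itv /= => r01.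
have := hd r r01 r1; rewrite mul1r distrC => hE.
have -> : line x u s - line x u r =
    - (line x u r - line x u s - dline x u s * (r - s)) - dline x u s * (r - s).
  by ring.
apply: le_trans (ler_normB _ _) _; rewrite normrN normrM.
move: r2; rewrite ltr_pdivlMr // mulrC /k mulrDl mul1r.
by move: hE; rewrite distrC; lra.
Qed.

(** The claim is psi 0 <= psi 1, where psi subtracts from [omega] on the segment its tangent slope
    at 0 and the quadratic c s^2 / 2; strong convexity makes psi' nonnegative inside. *)
Lemma bregman_ge x u : X x -> X u -> nu (x - u) ^+ 2 / 2 <= V x u.
Proof.
move=> Xx Xu; set c := nu (x - u) ^+ 2.
pose psi (s : R) : R := line x u s - dline x u 0 * s - c / 2 * s ^+ 2.
suff : psi 0 <= psi 1.
  rewrite /psi /line /dline !scale0r !addr0 !scale1r addrCA subrr addr0.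
  by rewrite /bregman; lra.
(* Strong convexity between x + s (u - x) and x gives a bound with factor s^2 on the left and s on
   the right; divide by s. *)
have mono (s : R) : 0 <= s <= 1 -> c * s <= dline x u s - dline x u 0.
  move=> /andP[s0 s1]; rewrite /dline scale0r addr0.
  have [->|s_neq0] := eqVneq s 0.
    by rewrite scale0r addr0 mulr0 subrr.
  have s_gt0 : 0 < s by rewrite lt_neqAle eq_sym s_neq0.
  have Xp := convex_set_comb X_convex Xx Xu s0 s1.
  have := prox_strongly_convex omega_prox Xp Xx.
  have -> : x + s *: (u - x) - x = s *: (u - x) by rewrite addrAC subrr add0r.
  rewrite is_norm_homogeneous // -[in nu _]opprB is_normN // ger0_norm //.
  by rewrite exprMn -/c dotpZr expr2 -mulrA ler_pM2l // mulrC dotpDl dotpNl.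
have psiE : psi = line x u - dline x u 0 *: (id : R -> R) -
    (c / 2) *: (id : R -> R) ^+ 2 by apply/funext.
have dpsi (s : R) : s \in `]0, 1[ ->
    is_derive s 1 psi (dline x u s - dline x u 0 - c * s).
  rewrite in_itv /= => /andP[s0 s1].
  have dl := is_derive_line Xx Xu s0 s1.
  rewrite psiE; apply: is_derive_eq.
  by rewrite /GRing.scale /=; field.
apply: (@ger0_derive1_le_cc R psi 0 1); rewrite ?in_itv /= ?lexx ?ler01 //.
- by move=> s /dpsi [].
- move=> s s01; have ds := dpsi s s01; rewrite derive1E derive_val.
  move: s01; rewrite in_itv /= => /andP[s0 s1].
  by have := mono s; rewrite (ltW s0) (ltW s1) //= => /(_ isT); lra.
- rewrite psiE => s; apply: continuousB; first apply: continuousB.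
  + exact: line_continuous.
  + by apply: continuousZl_tmp; apply: continuous_subspaceT => r; exact: cvg_id.
  + apply: continuousZl_tmp; apply: continuous_subspaceT => r.
    exact: (@exprn_continuous R 2 r).
Qed.

Lemma bregman_ge0 x u : X x -> X u -> 0 <= V x u.
Proof.
by move=> Xx Xu; apply: le_trans (bregman_ge Xx Xu); rewrite divr_ge0 ?sqr_ge0.
Qed.

(** By the three-point identities the claim is the first-order optimality condition q >= 0 in the
    direction v - u. If q < 0, a small move s towards v changes the objective by s q + o(s),
    contradicting minimality. *)
Lemma prox_step x u' u (g : 'rV[R]_d) (a b : R) :
  X x -> X u' -> 0 <= a -> 0 <= b ->
  argmin X (fun v => dotp g v + a * V x v + b * V u' v) u ->
  forall v, X v -> dotp g u + a * V x u + b * V u' u + (a + b) * V u v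
    <= dotp g v + a * V x v + b * V u' v.
Proof.
move=> Xx Xu' a0 b0 [Xu u_min] v Xv.
pose q := dotp (g + a *: (gomega u - gomega x)
                  + b *: (gomega u - gomega u')) (v - u).
suff : 0 <= q.
  by rewrite /q dotpDl dotpDl !dotpZl !bregman_three_points !dotpE; lra.
rewrite leNgt; apply/negP => q_lt0.
(* Constants chosen so that the remainder (a + b) V u p is at most half of the linear decrease s (-
   q); the + 1 keeps k positive. *)
pose k := (a + b) * `|v - u| + 1.
have k_gt0 : 0 < k by rewrite ltr_wpDl // mulr_ge0 ?addr_ge0.
have eps_gt0 : 0 < - q / (2 * k) by rewrite divr_gt0 ?oppr_gt0 ?mulr_gt0.
have [delta delta_gt0 h] := bregman_littleo Xu eps_gt0.
have k1 : 0 < `|v - u| + 1 by rewrite ltr_wpDl.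
(* The cap 1 keeps p in X; the other keeps p within [delta] of u. *)
pose s := Num.min 1 (delta / 2 / (`|v - u| + 1)).
have s_gt0 : 0 < s by rewrite lt_min ltr01 !divr_gt0.
have s_le1 : s <= 1 by rewrite ge_min lexx.
pose p := u + s *: (v - u).
have Xp : X p := convex_set_comb X_convex Xu Xv (ltW s_gt0) s_le1.
have pu : p - u = s *: (v - u) by rewrite /p addrAC subrr add0r.
have npu : `|p - u| = s * `|v - u| by rewrite pu normrZ gtr0_norm.
have small : `|p - u| < delta.
  rewrite npu; apply: (@le_lt_trans _ _ (delta / 2)); last first.
    by rewrite ltr_pdivrMr // mulr_natr mulr2n ltrDl.
  apply: (@le_trans _ _ (s * (`|v - u| + 1))).
    by rewrite ler_wpM2l ?lerDl // ltW.
  by rewrite -ler_pdivlMr // ge_min lexx orbT.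
have := h _ Xp small; rewrite npu => /(le_trans (ler_norm _)) hV.
have := u_min _ Xp.
(* An exact expansion: both Bregman terms, recentred at u, contribute the same remainder V u p. *)
have -> : dotp g p + a * V x p + b * V u' p =
    dotp g u + a * V x u + b * V u' u + s * q + (a + b) * V u p.
  have -> : s * q = dotp (g + a *: (gomega u - gomega x) +
      b *: (gomega u - gomega u')) (p - u) by rewrite pu dotpZr.
  by rewrite dotpDl dotpDl !dotpZl !bregman_three_points !dotpE; ring.
have hab := ler_wpM2l (addr_ge0 a0 b0) hV.
have hq : (a + b) * (- q / (2 * k) * (s * `|v - u|)) <= s * (- q) / 2.
  have -> : (a + b) * (- q / (2 * k) * (s * `|v - u|)) =
    s * (- q) / 2 * (((a + b) * `|v - u|) / k) by field; rewrite gt_eqF.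
  rewrite ler_piMr //; first by rewrite divr_ge0 // mulr_ge0 ?ltW ?oppr_gt0.
  by rewrite ler_pdivrMr // mul1r lerDl.
have sq : 0 < s * (- q) by rewrite mulr_gt0 ?oppr_gt0.
by move: (le_trans hab hq) => hs h1; lra.
Qed.

End Bregman.

(** * The inner loop *)

Lemma sum_nat_cst1 (R : realType) (n : nat) :
  \sum_(1 <= k < n.+1) (k%:R : R) = n%:R * (n%:R + 1) / 2.
Proof.
elim: n => [|n IH]; first by rewrite big_geq // !mul0r.
by rewrite big_nat_recr //= IH -natr1; field.
Qed.

(** A single subgradient g at the weighted mean q suffices, since the linear terms cancel: the
    weighted sum of p_t - q is zero. *)
Lemma jensen_subgradient (R : realType) (m d : nat) (phi : 'M[R]_(m, d) -> R)
    (g : 'M[R]_(m, d)) (c : nat -> R) (p : nat -> 'M[R]_(m, d)) (n : nat) :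
  let S := \sum_(1 <= t < n.+1) c t in
  let q := S^-1 *: \sum_(1 <= t < n.+1) c t *: p t in
  0 < S -> (forall t, (1 <= t <= n)%N -> 0 <= c t) ->
  (forall t, (1 <= t <= n)%N -> phi q + dotp g (p t - q) <= phi (p t)) ->
  S * phi q <= \sum_(1 <= t < n.+1) c t * phi (p t).
Proof.
move=> S q S_gt0 c_ge0 hphi.
apply: (@le_trans _ _ (\sum_(1 <= t < n.+1) c t * (phi q + dotp g (p t - q)))).
  under eq_bigr => t _.
    rewrite dotpDr dotpNr addrA addrAC mulrDr -dotpZr.
    over.
  rewrite big_split -mulr_suml -dotp_sumr -/S /=.
  have -> : \sum_(1 <= t < n.+1) c t *: p t = S *: q.
    by rewrite scalerA divff ?gt_eqF // scale1r.
  by rewrite dotpZr mulrBr subrK.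
rewrite big_nat [leRHS]big_nat; apply: ler_sum => t tn.
by rewrite ler_wpM2l ?c_ge0 ?hphi.
Qed.

Section InnerLoop.
Variables (R : realType) (d : nat) (X : set 'rV[R]_d) (nu : 'rV[R]_d -> R).
Variables (omega : 'rV[R]_d -> R) (gomega : 'rV[R]_d -> 'rV[R]_d).
Hypothesis X_convex : convex_set (X : set (convex_lmodType 'rV[R]_d)).
Hypothesis nu_norm : is_norm nu.
Hypothesis omega_prox : prox_function X nu omega gomega.
Local Notation V := (bregman omega gomega).
Variables (f : 'rV[R]_d -> R) (f' : 'rV[R]_d -> 'rV[R]_d) (mu M C : R).
Hypothesis mu_gt0 : 0 < mu.
Hypothesis C_gt0 : 0 < C.
Hypothesis f'_subgradient : forall y, X y -> subdifferential X f y (f' y).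
Hypothesis f_bounds : forall x y, X x -> X y ->
  mu / 2 * nu (x - y) ^+ 2 <= f x - f y - dotp (f' y) (x - y)
    <= M * nu (x - y).
Hypothesis quadratic_growth : forall x u, X x -> X u ->
  V x u <= C / 2 * nu (x - u) ^+ 2.

Variables (w x : 'rV[R]_d) (eta : R) (beta : nat -> R) (T : nat).
Variable (u : nat -> 'rV[R]_d).
Hypothesis Xx : X x.
Hypothesis eta_gt0 : 0 < eta.
Hypothesis betaE : forall t, (1 <= t)%N ->
  eta * beta t = (t%:R + 1) * mu / (2 * C) + (t%:R - 1) * eta / 2.
Hypothesis u0 : u 0%N = x.
Hypothesis u_argmin : forall t, (1 <= t <= T)%N ->
  argmin X (fun v => dotp (w + f' (u (t - 1)%N)) v + eta * V x v
                     + eta * beta t * V (u (t - 1)%N) v) (u t).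

Lemma inner_mem t : (t <= T)%N -> X (u t).
Proof.
case: t => [|t] tT; first by rewrite u0.
by case: (@u_argmin t.+1 tT).
Qed.

(** The prox step is combined with the upper bound on f at u_t and the strong convexity bound at v,
    both linearised at the previous iterate z. Quadratic growth converts mu/2 |z - v|^2 into (mu /
    C) V z v, and b V z u_t absorbs M |z - u_t|. *)
Lemma inner_step t v : (1 <= t <= T)%N -> X v ->
  t%:R * (f (u t) + dotp w (u t) + eta * V x (u t)
          - (f v + dotp w v + eta * V x v))
  <= t%:R * (t%:R - 1) / 2 * (mu / C + eta) * V (u (t - 1)%N) v
     - t%:R * (t%:R + 1) / 2 * (mu / C + eta) * V (u t) v
     + t%:R * M ^+ 2 / (2 * (eta * beta t)).
Proof.
move=> /andP[t1 tT] Xv.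
have t1R : 1 <= t%:R :> R by rewrite ler1n.
set b := eta * beta t; have bE : b = _ := betaE t1.
have b_gt0 : 0 < b.
  have p1 : 0 < (t%:R + 1) * mu / (2 * C).
    by rewrite divr_gt0 ?mulr_gt0 // ltr_wpDl // ler0n.
  have p2 : 0 <= (t%:R - 1) * eta / 2.
    by rewrite divr_ge0 // mulr_ge0 ?subr_ge0 // ltW.
  by rewrite bE; lra.
set z := u (t - 1)%N.
have Xz : X z by apply: inner_mem; rewrite (leq_trans (leq_subr _ _) tT).
have Xu : X (u t) by exact: inner_mem.
have t1T : (1 <= t <= T)%N by rewrite t1.
have := prox_step X_convex omega_prox Xx Xz (ltW eta_gt0) (ltW b_gt0)
  (u_argmin t1T) Xv.
rewrite -/z !(dotpDl w) => step.
have /andP[_ up] := f_bounds Xu Xz.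
have /andP[low _] := f_bounds Xv Xz.
have growth := quadratic_growth Xz Xv.
have breg := bregman_ge X_convex nu_norm omega_prox Xz Xu.
move: up low breg growth; rewrite !dotpDr !dotpNr.
rewrite -(is_normN nu_norm (u t - z)) -(is_normN nu_norm (v - z)) !opprB.
set r := nu (z - u t); set r' := nu (z - v) => up low breg growth.
have low' : mu / C * V z v <= mu / 2 * r' ^+ 2.
  have := ler_wpM2l (ltW (divr_gt0 mu_gt0 C_gt0)) growth.
  by congr (_ <= _); field; rewrite gt_eqF.
(* AM-GM: [M r <= b r^2 / 2 + M^2 / (2 b)] *)
have amgm : M * r <= b * (r ^+ 2 / 2) + M ^+ 2 / (2 * b).
  rewrite -subr_ge0.
  have -> : b * (r ^+ 2 / 2) + M ^+ 2 / (2 * b) - M * r =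
      (b * r - M) ^+ 2 / (2 * b).
    by field; rewrite gt_eqF.
  by rewrite divr_ge0 ?sqr_ge0 // mulr_ge0 // ltW.
have bbreg := ler_wpM2l (ltW b_gt0) breg.
have main :
    f (u t) + dotp w (u t) + eta * V x (u t) - (f v + dotp w v + eta * V x v)
    <= (b - mu / C) * V z v - (eta + b) * V (u t) v + M ^+ 2 / (2 * b).
  by lra.
(* The choice of [beta] gives b - mu/C = (t - 1)/2 (mu/C + eta) and eta + b = (t + 1)/2 (mu/C +
   eta), so weights t make consecutive terms match. *)
apply: le_trans (ler_wpM2l (ler0n R t) main) _.
rewrite le_eqVlt; apply/orP; left; apply/eqP; rewrite mulrDr mulrBr.
congr (_ - _ + _); last by rewrite mulrA.
- by rewrite bE; field; rewrite gt_eqF.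
- by rewrite bE; field; rewrite gt_eqF.
Qed.

(** Telescoping of the single steps. The step t = 1 costs M^2 C / (2 mu), each later one at most 2
    M^2 / (mu/C + eta). *)
Lemma inner_sum v : X v -> (1 <= T)%N ->
  \sum_(1 <= t < T.+1) t%:R * (f (u t) + dotp w (u t) + eta * V x (u t))
    - T%:R * (T%:R + 1) / 2 * (f v + dotp w v + eta * V x v)
  <= - (T%:R * (T%:R + 1) / 2 * (mu / C + eta) * V (u T) v)
     + M ^+ 2 * (C / (2 * mu) + 2 * (T%:R - 1) / (mu / C + eta)).
Proof.
move=> Xv T_gt0; have k_gt0 : 0 < mu / C + eta by rewrite addr_gt0 ?divr_gt0.
suff H n : (1 <= n <= T)%N ->
    \sum_(1 <= t < n.+1) t%:R * (f (u t) + dotp w (u t) + eta * V x (u t)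
       - (f v + dotp w v + eta * V x v))
    <= - (n%:R * (n%:R + 1) / 2 * (mu / C + eta) * V (u n) v)
       + M ^+ 2 * (C / (2 * mu) + 2 * (n%:R - 1) / (mu / C + eta)).
  have := H T; rewrite T_gt0 leqnn => /(_ isT).
  under eq_bigr => t _ do rewrite mulrBr.
  by rewrite big_split /= sumrN -mulr_suml sum_nat_cst1.
elim: n => [//|n IH] /andP[_ nT].
have := inner_step (t := n.+1) _ Xv; rewrite nT subn1 /= => /(_ isT) step.
rewrite big_nat_recr //=.
(* At t = 1 the [eta] part of b vanishes and b = mu / C. *)
have [n0|n_gt0] := posnP n.
  rewrite n0 in step *; rewrite big_geq // add0r; apply: le_trans step _.
  rewrite betaE // subrr !mul0r addr0.
  have -> : 1 * M ^+ 2 / (2 * ((1 + 1) * mu / (2 * C))) =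
      M ^+ 2 * (C / (2 * mu)).
    by field; rewrite !gt_eqF.
  by lra.
have := IH; rewrite n_gt0 (ltnW nT) => /(_ isT) IHn.
(* With t = n + 1, 2 b >= n (mu/C + eta), and (n + 1) / n <= 2. *)
have err : n.+1%:R * M ^+ 2 / (2 * (eta * beta n.+1)) <=
    M ^+ 2 * (2 / (mu / C + eta)).
  have n1 : 1 <= n%:R :> R by rewrite ler1n.
  rewrite betaE // -natr1 addrK.
  have p1 : 0 < n%:R * (mu / C + eta).
    by rewrite mulr_gt0 // (lt_le_trans ltr01).
  have -> : 2 * ((n%:R + 1 + 1) * mu / (2 * C) + n%:R * eta / 2) =
      n%:R * (mu / C + eta) + 2 * (mu / C) by field; rewrite gt_eqF.
  have p2 : 0 < mu / C by rewrite divr_gt0.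
  rewrite ler_pdivrMr; last by lra.
  rewrite (mulrC _ (M ^+ 2)) -[leRHS]mulrA ler_wpM2l ?sqr_ge0 //.
  rewrite mulrAC ler_pdivlMr //.
  by nra.
by rewrite -natr1 in step err *; lra.
Qed.

(** Division of the summed inequality by the total weight T (T + 1) / 2, after Jensen for f + <w, .>
    + eta V x. *)
Lemma inner_loop v : X v -> (1 <= T)%N ->
  let q := (\sum_(1 <= t < T.+1) t%:R)^-1 *: \sum_(1 <= t < T.+1) t%:R *: u t in
  X q /\
  f q + dotp w q + eta * V x q + (mu / C + eta) * V (u T) v
  <= f v + dotp w v + eta * V x v
     + 2 * M ^+ 2 / (T%:R * (T%:R + 1))
       * (C / (2 * mu) + 2 * (T%:R - 1) / (mu / C + eta)).
Proof.
move=> Xv T_gt0 q.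
have T1 : 1 <= T%:R :> R by rewrite ler1n.
have T_gt0R : 0 < T%:R :> R by rewrite ltr0n.
have S_gt0 : 0 < T%:R * (T%:R + 1) / 2 :> R.
  by rewrite divr_gt0 ?mulr_gt0 // ltr_wpDl.
have Xq : X q.
  apply: convex_set_avg => // t /andP[t1 tT]; first by rewrite ltr0n.
  exact: inner_mem.
split=> //; rewrite -(ler_pM2l S_gt0).
(* The given vector is a subgradient at q: for the Bregman part the slack is V q (u t) >= 0. *)
have := @jensen_subgradient R 1 d (fun v => f v + dotp w v + eta * V x v)
  (f' q + w + eta *: (gomega q - gomega x)) (fun t => t%:R) u T.
rewrite /= -/q sum_nat_cst1 => /(_ S_gt0 (fun t _ => ler0n R t)) jensen.
have {}jensen := jensen _.
have := inner_sum Xv T_gt0; set E := M ^+ 2 * _ => h.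
have -> : 2 * M ^+ 2 / (T%:R * (T%:R + 1)) *
    (C / (2 * mu) + 2 * (T%:R - 1) / (mu / C + eta)) =
    E / (T%:R * (T%:R + 1) / 2).
  rewrite /E; set K := _ + _ / _; field.
  by rewrite !gt_eqF // ltr_wpDl.
rewrite [leLHS]mulrDr [leRHS]mulrDr [X in _ <= _ + X]mulrC divfK ?gt_eqF //.
apply: le_trans (lerD (jensen _) (lexx _)) _; last by lra.
move=> t tT; have Xt : X (u t) by apply: inner_mem; case/andP: tT.
have hf : f q + dotp (f' q) (u t - q) <= f (u t) := f'_subgradient Xq Xt.
have hV : V x q + dotp (gomega q - gomega x) (u t - q) <= V x (u t).
  rewrite (bregman_three_points omega).
  by have := bregman_ge0 X_convex nu_norm omega_prox Xq Xt; lra.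
have := ler_wpM2l (ltW eta_gt0) hV; move: hf.
by rewrite !dotpE; lra.
Qed.

End InnerLoop.

(** * The outer loop *)

Section CrossTerm.
Variables (R : realType) (m d : nat) (e : rel 'I_m).
Variable (nu : 'I_m -> 'rV[R]_d -> R).
Hypothesis nu_norm : forall i, is_norm (nu i).

(** Cauchy-Schwarz, the operator norm and Young. The slack is a square plus a multiple of (n + 1) (n
    - 1), nonnegative from n = 1 on. *)
Lemma cross_term (kappa : R) (n : nat) (b v : 'M[R]_(m, d)) :
  0 < kappa -> (0 < n)%N ->
  (n%:R + 1) * dotp (boldL e b) v <=
  n%:R * (n%:R + 1) * kappa / 4 * pnorm nu b ^+ 2
  + 4 * normL nu e ^+ 2 / kappa / 2 * dotp v v.
Proof.
move=> kappa_gt0 n_gt0.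
set ell := normL nu e.
have n1 : 1 <= n%:R :> R by rewrite ler1n.
have cs := dotp_le_enorm (boldL e b) v.
have op := enorm_boldL e nu_norm b.
rewrite -sqr_enorm.
have r0 := enorm_ge0 v; have p0 := pnorm_ge0 nu b.
set r := enorm v in cs r0 *; set p := pnorm nu b in op p0 *.
have {}cs : dotp (boldL e b) v <= ell * p * r.
  by apply: le_trans cs _; rewrite ler_wpM2r.
apply: (@le_trans _ _ ((n%:R + 1) * (ell * p * r))).
  by rewrite ler_wpM2l // addr_ge0.
rewrite -subr_ge0.
have -> : n%:R * (n%:R + 1) * kappa / 4 * p ^+ 2
    + 4 * ell ^+ 2 / kappa / 2 * r ^+ 2 - (n%:R + 1) * (ell * p * r) =
  (((n%:R + 1) * kappa * p - 4 * ell * r) ^+ 2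
    + (n%:R + 1) * (n%:R - 1) * (kappa * p) ^+ 2) / (8 * kappa).
  by field; rewrite gt_eqF.
apply: divr_ge0; last by rewrite mulr_ge0 // ltW.
apply: addr_ge0 (sqr_ge0 _) (mulr_ge0 _ (sqr_ge0 _)).
by rewrite mulr_ge0 ?subr_ge0 ?addr_ge0.
Qed.

End CrossTerm.

Section OuterLoop.
Variables (R : realType) (m d : nat) (e : rel 'I_m).
Variable (nu : 'I_m -> 'rV[R]_d -> R).
Hypothesis nu_norm : forall i, is_norm (nu i).
Variables (P : set 'M[R]_(m, d)) (F : 'M[R]_(m, d) -> R).
Variable (V : 'M[R]_(m, d) -> 'M[R]_(m, d) -> R).
Hypothesis V_ge : forall a b, P a -> P b -> pnorm nu (b - a) ^+ 2 / 2 <= V a b.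
Variables (kappa : R) (N : nat) (eps : nat -> R).
Variables (x xhat y : nat -> 'M[R]_(m, d)).
Hypothesis kappa_gt0 : 0 < kappa.
Hypothesis xP : forall k, (k <= N)%N -> P (x k).
Hypothesis xhatP : forall k, (1 <= k <= N)%N -> P (xhat k).
Hypothesis xhat0 : xhat 0%N = x 0%N.
Local Notation ell := (normL nu e).
Local Notation L := (boldL e).
(** The value of (k + 1) tau_k, constant in k, so that the dual terms telescope. *)
Let c : R := 4 * ell ^+ 2 / kappa.
Let delta k := xhat k - x (k - 1)%N.
Hypothesis primal_step : forall k z, (1 <= k <= N)%N -> P z ->
  F (xhat k) + dotp (L (xhat k)) (y k)
    + k%:R * kappa / 2 * V (x (k - 1)%N) (xhat k)
    + (k%:R + 2) * kappa / 2 * V (x k) z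
  <= F z + dotp (L z) (y k) + k%:R * kappa / 2 * V (x (k - 1)%N) z + eps k.
(** The dual update multiplied by (k + 1) tau_k, with the extrapolation expanded through (k + 1)
    alpha_k = k. *)
Hypothesis dual_step : forall k, (1 <= k <= N)%N ->
  (k%:R + 1) *: L (xhat k) =
    c *: (y k - y (k - 1)%N)
    + ((k%:R + 1) *: L (delta k) - k%:R *: L (delta (k - 1)%N)).

(** Truncated subtraction gives [delta 0] = xhat^0 - x^0; its vanishing starts both telescopings. *)
Let delta0 : delta 0 = 0.
Proof. by rewrite /delta xhat0 subrr. Qed.

Lemma dual_sum n : (n <= N)%N ->
  \sum_(1 <= k < n.+1) (k%:R + 1) *: L (xhat k) =
  c *: (y n - y 0%N) + (n%:R + 1) *: L (delta n).
Proof.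
elim: n => [|n IH] nN.
  by rewrite big_geq // subrr scaler0 delta0 boldL0 scaler0 addr0.
rewrite big_nat_recr //= IH ?(ltnW nN) // dual_step ?subn1 //=.
rewrite -natr1 addrACA -scalerDr; congr (_ *: _ + _).
  by rewrite addrC subrKA.
by rewrite addrC subrK.
Qed.

(** Induction carrying the boundary terms in [delta n]. Weight k + 1 aligns the coefficients of
    V(x_k, z); polarisation of <y_k - y_n, yy - y_k>, k = n + 1, frees the square of y_k - y_n,
    which together with the square of [delta n] absorbs the cross term. *)
Lemma gap_sum n z yy : (n <= N)%N -> P z ->
  \sum_(1 <= k < n.+1)
     (k%:R + 1) * (F (xhat k) + dotp (L (xhat k)) yy - F z - dotp (L z) (y k))
  <= kappa * V (x 0%N) z - (n%:R + 1) * (n%:R + 2) * kappa / 2 * V (x n) z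
     + c / 2 * (dotp (yy - y 0%N) (yy - y 0%N) - dotp (yy - y n) (yy - y n))
     + \sum_(1 <= k < n.+1) (k%:R + 1) * eps k
     + (n%:R + 1) * dotp (L (delta n)) (yy - y n)
     - n%:R * (n%:R + 1) * kappa / 4 * pnorm nu (delta n) ^+ 2.
Proof.
move=> nN Pz; elim: n nN => [|n IH] nN.
  rewrite !big_geq // subrr delta0 boldL0 dotp0l !mul0r !mulr0 add0r.
  by lra.
rewrite !(big_nat_recr n.+1) //=.
have step := primal_step (k := n.+1) nN Pz.
have dual := dual_step (k := n.+1) nN.
rewrite subn1 /= in step dual.
have {IH} := IH (ltnW nN).
set A := \sum_(1 <= k < n.+1) _; set E := \sum_(1 <= k < n.+1) _ => IH.
have Px : P (x n) by apply: xP; exact: ltnW.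
have breg := V_ge Px (xhatP (k := n.+1) nN).
have -> : delta n.+1 = xhat n.+1 - x n by rewrite /delta subn1.
rewrite [in delta n.+1]/delta subn1 /= in dual.
set k := n.+1 in step dual breg *.
have kE : k%:R = n%:R + 1 :> R by rewrite natr1.
rewrite kE in step dual *.
(* AM-GM on the cross term; at [n = 0] it vanishes because [delta 0 = 0]. *)
have cross : (n%:R + 1) * dotp (L (delta n)) (y k - y n) <=
    n%:R * (n%:R + 1) * kappa / 4 * pnorm nu (delta n) ^+ 2
    + c / 2 * dotp (y k - y n) (y k - y n).
  have [n0|n_gt0] := posnP n.
    rewrite n0 delta0 boldL0 dotp0l mulr0 !mul0r add0r.
    have c_ge0 : 0 <= c.
      by apply: divr_ge0 (ltW kappa_gt0); rewrite mulr_ge0 ?sqr_ge0.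
    by rewrite mulr_ge0 ?dotp_ge0 // divr_ge0.
  exact: cross_term.
have dualE : (n%:R + 1 + 1) * dotp (L (xhat k)) (yy - y k) =
    c * dotp (y k - y n) (yy - y k)
    + (n%:R + 1 + 1) * dotp (L (xhat k - x n)) (yy - y k)
    - (n%:R + 1) * dotp (L (delta n)) (yy - y k).
  by rewrite -dotpZl dual !(dotpDl, dotpNl, dotpZl); ring.
have n0R : 0 <= n%:R :> R := ler0n _ _.
have {}step : (n%:R + 1 + 1) * (F (xhat k) + dotp (L (xhat k)) (y k)
      + (n%:R + 1) * kappa / 2 * (pnorm nu (xhat k - x n) ^+ 2 / 2)
      + (n%:R + 1 + 2) * kappa / 2 * V (x k) z) <=
    (n%:R + 1 + 1) * (F z + dotp (L z) (y k)
      + (n%:R + 1) * kappa / 2 * V (x n) z + eps k).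
  rewrite ler_wpM2l ?addr_ge0 //; apply: le_trans step.
  by rewrite lerD2r lerD2l ler_wpM2l // divr_ge0 // mulr_ge0 ?addr_ge0 // ltW.
move: IH step cross dualE; rewrite !(dotpDr, dotpNr) !(dotpDl, dotpNl).
rewrite !(dotpC (y _) yy) (dotpC (y k) (y n)).
by lra.
Qed.

End OuterLoop.

(** * Scalar estimates: accumulated inner errors and the infeasibility constant *)

Lemma sum_nat_succ (R : realType) (n : nat) :
  \sum_(1 <= k < n.+1) (k%:R + 1 : R) = n%:R * (n%:R + 3) / 2.
Proof.
rewrite big_split /= sum_nat_cst1 sumr_const_nat subn1 /=.
by field.
Qed.

(** With b = s M / kappa, the two branches of the maximum give T >= b N, for the error part in
    1/T^2, and T >= 4 b^2 N, for the part in 1/T. *)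
Lemma inexactness_bound (R : realType) (kappa M D T m : R) (N : nat) :
  0 < kappa -> 0 < M -> 0 < D -> 0 < m -> (2 <= N)%N -> 1 <= T ->
  Num.sqrt (2 * m / D) * (M * N%:R / kappa)
    * Num.max (Num.sqrt (2 * m / D) * (4 * M / kappa)) 1 <= T ->
  \sum_(1 <= k < N.+1) (k%:R + 1) *
    (m * (2 * M ^+ 2 / (T * (T + 1))
       * (kappa^-1 / 2 + 2 * (T - 1) / (kappa + k%:R * kappa / 2))))
  <= 2 * kappa * D.
Proof.
move=> kappa_gt0 M_gt0 D_gt0 m_gt0 N2 T1.
set s := Num.sqrt _ => hT.
have s2 : s ^+ 2 = 2 * m / D by rewrite sqr_sqrtr // divr_ge0 ?mulr_ge0 // ltW.
have s_gt0 : 0 < s by rewrite sqrtr_gt0 divr_gt0 ?mulr_gt0.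
pose b : R := s * M / kappa; have b_gt0 : 0 < b by rewrite divr_gt0 ?mulr_gt0.
have n2 : 2 <= N%:R :> R by rewrite (ler_nat _ 2).
have T_gt0 : 0 < T by rewrite (lt_le_trans ltr01).
have bN_gt0 : 0 < b * N%:R by rewrite mulr_gt0 // (lt_le_trans _ n2).
have hT' : b * N%:R * Num.max (4 * b) 1 <= T.
  apply: le_trans hT; rewrite le_eqVlt; apply/orP; left; apply/eqP; rewrite /b.
  by congr (_ * Num.max _ _); field; rewrite gt_eqF.
have T_lin : b * N%:R <= T.
  by apply: le_trans hT'; rewrite ler_peMr ?le_max ?lexx ?orbT // ltW.
have T_quad : 4 * b ^+ 2 * N%:R <= T.
  apply: le_trans hT'; apply: (@le_trans _ _ (b * N%:R * (4 * b))).
    by rewrite le_eqVlt; apply/orP; left; apply/eqP; ring.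
  by apply: ler_wpM2l; [exact: ltW|rewrite le_max lexx].
pose K := m * (2 * M ^+ 2) / (T * (T + 1) * kappa).
have K_ge0 : 0 <= K.
  by rewrite divr_ge0 ?mulr_ge0 ?addr_ge0 ?sqr_ge0 // ltW.
(* Since kappa + k kappa / 2 = (k + 2) kappa / 2, the weight k + 1 cancels up to (k + 1) / (k + 2)
   <= 1. *)
apply: (@le_trans _ _
  (\sum_(1 <= k < N.+1) K * ((k%:R + 1) / 2 + 4 * (T - 1)))).
  apply: ler_sum => k _.
  have k0 : 0 <= k%:R :> R := ler0n _ _.
  have -> : (k%:R + 1) * (m * (2 * M ^+ 2 / (T * (T + 1))
       * (kappa^-1 / 2 + 2 * (T - 1) / (kappa + k%:R * kappa / 2)))) =
     K * ((k%:R + 1) / 2 + 4 * (T - 1) * ((k%:R + 1) / (k%:R + 2))).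
    rewrite /K; field.
    have h1 : k%:R + 2 != 0 :> R by rewrite gt_eqF // ltr_wpDl.
    have h2 : T + 1 != 0 by rewrite gt_eqF // addr_gt0.
    rewrite h1 h2 !gt_eqF //=.
    by have := mulr_ge0 k0 (ltW kappa_gt0); lra.
  rewrite ler_wpM2l // lerD2l ler_piMr ?mulr_ge0 ?subr_ge0 //.
  by rewrite ler_pdivrMr ?ltr_wpDl // mul1r lerD2l ler1n.
rewrite -mulr_sumr big_split /= -mulr_suml sum_nat_succ sumr_const_nat subn1 /=.
rewrite -[(4 * _) *+ N]mulr_natr.
have mE : m = b ^+ 2 * kappa ^+ 2 * D / (2 * M ^+ 2).
  have -> : b ^+ 2 = s ^+ 2 * (M / kappa) ^+ 2 by rewrite /b; ring.
  by rewrite s2; field; rewrite !gt_eqF.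
have -> : K = kappa * D * (b ^+ 2 / (T * (T + 1))).
  rewrite /K mE; field; rewrite !gt_eqF // addr_gt0 //.
have -> : 2 * kappa * D = kappa * D * 2 by ring.
rewrite -mulrA ler_pM2l ?mulr_gt0 // mulrAC ler_pdivrMr ?mulr_gt0 ?addr_gt0 //.
have sqT : b ^+ 2 * N%:R ^+ 2 <= T ^+ 2.
  by rewrite -exprMn ler_pXn2r // nnegrE ltW.
have b2_ge0 := sqr_ge0 b.
(* N >= 2 gives N + 3 <= 5 N / 2. *)
have n_sqr : b ^+ 2 * (N%:R * (N%:R + 3)) <= 5 / 2 * (b ^+ 2 * N%:R ^+ 2).
  rewrite [leRHS]mulrCA ler_wpM2l //.
  by have : 0 <= N%:R * (N%:R - 2) :> R; [rewrite mulr_ge0 ?subr_ge0|lra].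
have T1_ge0 : 0 <= T - 1 by rewrite subr_ge0.
by have := ler_wpM2r T1_ge0 T_quad; have := sqr_ge0 T; lra.
Qed.

(** In the scaled variables p, q, rho the hypothesis bounds 2 p^2 - 4 p q + 4 N / (N + 1) q^2. This
    form degenerates at N = 1; for N >= 2 the last coefficient is at least 8/3 and the form controls
    (p + q)^2. *)
Lemma feasibility_bound (R : realType) (ell kappa V0 D a b r : R) (N : nat) :
  0 <= ell -> 0 < kappa -> 0 <= V0 -> 0 < D -> 0 <= a -> 0 <= b -> 0 <= r ->
  (2 <= N)%N ->
  0 <= kappa * V0 + 4 * ell ^+ 2 / kappa / 2 * (r ^+ 2 - a ^+ 2)
       + 2 * kappa * D + (N%:R + 1) * (ell * b * a)
       - N%:R * (N%:R + 1) * kappa / 4 * b ^+ 2 ->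
  4 * ell ^+ 2 / kappa * (r + a) + (N%:R + 1) * (ell * b)
  <= 4 * ell * (3 * Num.sqrt (2 * D + V0) + 7 * ell * r / kappa).
Proof.
move=> ell_ge0 kappa_gt0 V0_ge0 D_gt0 a0 b0 r0 N2 gap.
have n2 : 2 <= N%:R :> R by rewrite (ler_nat _ 2).
set sg := Num.sqrt _.
have sg_ge0 : 0 <= sg by exact: sqrtr_ge0.
have sg2 : sg ^+ 2 = 2 * D + V0.
  by rewrite sqr_sqrtr // addr_ge0 ?mulr_ge0 // ltW.
pose p := ell * a / kappa; pose q := (N%:R + 1) * b / 4.
pose rho := ell * r / kappa.
have n1_gt0 : 0 < N%:R + 1 :> R by rewrite ltr_wpDl.
have p0 : 0 <= p by rewrite divr_ge0 ?mulr_ge0 // ltW.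
have q0 : 0 <= q by rewrite divr_ge0 ?mulr_ge0 // ltW.
have rho0 : 0 <= rho by rewrite divr_ge0 ?mulr_ge0 // ltW.
have -> : 4 * ell ^+ 2 / kappa * (r + a) + (N%:R + 1) * (ell * b) =
    4 * ell * (p + q + rho) by rewrite /p /q /rho; field; rewrite gt_eqF.
have -> : 7 * ell * r / kappa = 7 * rho by rewrite /rho; ring.
rewrite ler_wpM2l ?mulr_ge0 //.
have quad : 2 * p ^+ 2 - 4 * (p * q) + 4 * (N%:R / (N%:R + 1)) * q ^+ 2
    <= sg ^+ 2 + 2 * rho ^+ 2.
  rewrite sg2 -(ler_pM2l kappa_gt0) -subr_ge0; apply: le_trans gap _.
  rewrite le_eqVlt; apply/orP; left; apply/eqP; rewrite /p /q /rho; field.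
  by rewrite !gt_eqF.
have ratio : 2 / 3 <= N%:R / (N%:R + 1) :> R by rewrite ler_pdivlMr //; lra.
have {}quad :
    2 * p ^+ 2 - 4 * (p * q) + 8 / 3 * q ^+ 2 <= sg ^+ 2 + 2 * rho ^+ 2.
  by have := ler_wpM2r (sqr_ge0 q) ratio; lra.
(* One of the seven [rho] is the direct contribution of r. Squaring, 13/2 (sg^2 + 2 rho^2) <= (3 sg
   + 6 rho)^2. *)
suff : p + q <= 3 * sg + 6 * rho by lra.
have lhs_ge0 : 0 <= p + q by rewrite addr_ge0.
have rhs_ge0 : 0 <= 3 * sg + 6 * rho by lra.
rewrite -(@ler_pXn2r _ 2) //.
(* [13/2 (2 p^2 - 4 p q + 8/3 q^2) - (p + q)^2 = (6 p - 7 q)^2 / 3] *)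
have := sqr_ge0 (6 * p - 7 * q).
by have := mulr_ge0 sg_ge0 rho0; have := sqr_ge0 sg; have := sqr_ge0 rho; nra.
Qed.

(** * Convergence of the DCS method in the strongly convex case *)

Theorem theorem4 (R : realType) (m d : nat) (hm : (2 <= m)%N) (hd : (1 <= d)%N)
  (e : rel 'I_m) (e_sym : symmetric e) (e_conn : forall i j, connect e i j)
  (X : 'I_m -> set 'rV[R]_d)
  (X_closed : forall i, closed (X i))
  (X_convex : forall i, convex_set (X i))
  (X_meet : \bigcap_i X i !=set0)
  (nu : 'I_m -> 'rV[R]_d -> R) (nu_norm : forall i, is_norm (nu i))
  (f : 'I_m -> 'rV[R]_d -> R) (f' : 'I_m -> 'rV[R]_d -> 'rV[R]_d)
  (mu M : R) (mu_gt0 : 0 < mu) (M_gt0 : 0 < M)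
  (f_convex : forall i, convex_function (X i) (f i))
  (f'_subgradient : forall i y, X i y -> subdifferential (X i) (f i) y (f' i y))
  (f_bounds : forall i x y, X i x -> X i y ->
     mu / 2 * nu i (x - y) ^+ 2 <= f i x - f i y - dotp (f' i y) (x - y)
       <= M * nu i (x - y))
  (omega : 'I_m -> 'rV[R]_d -> R) (gomega : 'I_m -> 'rV[R]_d -> 'rV[R]_d)
  (omega_prox : forall i, prox_function (X i) (nu i) (omega i) (gomega i))
  (C : R) (C_gt0 : 0 < C)
  (quadratic_growth : forall i x u, X i x -> X i u ->
     bregman (omega i) (gomega i) x u <= C / 2 * nu i (x - u) ^+ 2)
  (xs ys : 'M[R]_(m, d))
  (xs_opt : optimal_solution e X f xs)
  (xs_ys_saddle : saddle_point e X f xs ys)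
  (N : nat) (hN : (2 <= N)%N) (D : R) (D_gt0 : 0 < D)
  (alpha tau eta : nat -> R) (T : nat -> nat)
  (lambda : nat -> R) (beta : nat -> nat -> R)
  (lambdaE : forall t, (1 <= t)%N -> lambda t = t%:R)
  (betaE : forall k t, (1 <= k <= N)%N -> (1 <= t)%N ->
     beta k t = (t%:R + 1) * mu / (2 * eta k * C) + (t%:R - 1) / 2)
  (alphaE : forall k, (1 <= k <= N)%N -> alpha k = k%:R / (k%:R + 1))
  (etaE : forall k, (1 <= k <= N)%N -> eta k = k%:R * mu / (2 * C))
  (tauE : forall k, (1 <= k <= N)%N ->
     tau k = 4 * normL nu e ^+ 2 * C / ((k%:R + 1) * mu))
  (TE : forall k, (1 <= k <= N)%N ->
     T k = absz (Num.ceil (Num.sqrt (2 * m%:R / D) * (C * M * N%:R / mu)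
                       * Num.max (Num.sqrt (2 * m%:R / D) * (4 * C * M / mu)) 1)))
  (x xhat xtilde y w : nat -> 'M[R]_(m, d)) (u : nat -> nat -> 'M[R]_(m, d))
  (run : dcs_run e X f' (fun i => bregman (omega i) (gomega i)) N
           alpha tau eta T lambda beta x xhat xtilde y w u) :
  let xavg := (2 / (N%:R * (N%:R + 3))) *:
                \sum_(1 <= k < N.+1) (k%:R + 1) *: xhat k in
  objective f xavg - objective f xs
    <= 2 / (N%:R * (N%:R + 3))
       * (mu / C * sum_bregman omega gomega (x 0%N) xs
          + 2 * normL nu e ^+ 2 * C / mu * enorm (y 0%N) ^+ 2
          + 2 * mu * D / C)
  /\
  enorm (boldL e xavg)
    <= 8 * normL nu e / (N%:R * (N%:R + 3))
       * (3 * Num.sqrt (2 * D + sum_bregman omega gomega (x 0%N) xs)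
          + 7 * normL nu e * C / mu * enorm (ys - y 0%N)).
Proof.
move=> xavg.
set V := sum_bregman omega gomega; set F := objective f; set P := prodset X.
set ell := normL nu e.
have ell_ge0 : 0 <= ell := normL_ge0 e nu_norm.
(* In terms of [kappa], eta_k = k kappa / 2 and (k + 1) tau_k = 4 ell^2 / kappa. *)
pose kappa := mu / C; have kappa_gt0 : 0 < kappa by rewrite divr_gt0.
have C_neq0 : C != 0 by rewrite gt_eqF.
have mu_neq0 : mu != 0 by rewrite gt_eqF.
have m_gt0 : 0 < m%:R :> R by rewrite ltr0n ltnW.
have N_gt0 : 0 < N%:R :> R by rewrite ltr0n ltnW.
set z0 := Num.sqrt (2 * m%:R / D) * (C * M * N%:R / mu) * _ in TE.
have z0_gt0 : 0 < z0.
  have s_gt0 : 0 < Num.sqrt (2 * m%:R / D).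
    by rewrite sqrtr_gt0 divr_gt0 ?mulr_gt0.
  rewrite /z0 !mulr_gt0 ?invr_gt0 //.
  by apply: lt_le_trans ltr01 _; rewrite le_max lexx orbT.
set T0 := `|_|%N in TE.
have T0_ge : z0 <= T0%:R.
  (* As z0 > 0, its ceiling is nonnegative and [absz] does not change it. *)
  rewrite /T0 natr_absz ger0_norm ?ceil_ge // ceil_ge0.
  by apply: lt_trans z0_gt0; rewrite oppr_lt0.
have T0_gt0 : (1 <= T0)%N by rewrite -(ltr0n R) (lt_le_trans z0_gt0).
have V_ge a b : P a -> P b -> pnorm nu (b - a) ^+ 2 / 2 <= V a b.
  move=> Pa Pb; rewrite sqr_pnorm mulr_suml; apply: ler_sum => i _.
  have := bregman_ge (@X_convex i) (nu_norm i) (omega_prox i) (Pa i) (Pb i).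
  by rewrite -(is_normN (nu_norm i)) opprB linearB.
have eta_gt0 k : (1 <= k <= N)%N -> 0 < eta k.
  move=> kN; rewrite etaE // divr_gt0 ?mulr_gt0 // ltr0n.
  by case/andP: kN.
have betaE' k t : (1 <= k <= N)%N -> (1 <= t)%N ->
    eta k * beta k t = (t%:R + 1) * mu / (2 * C) + (t%:R - 1) * eta k / 2.
  move=> kN t1; rewrite betaE //; have := eta_gt0 _ kN.
  by move: (eta k) => c c_gt0; field; rewrite ?C_neq0 ?gt_eqF.
have u_argmin k i : (1 <= k <= N)%N -> forall t, (1 <= t <= T k)%N ->
    argmin (X i) (fun v => dotp (row i (w k) + f' i (row i (u k (t - 1)%N))) v
      + eta k * bregman (omega i) (gomega i) (row i (x (k - 1)%N)) v
      + eta k * beta k t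
        * bregman (omega i) (gomega i) (row i (u k (t - 1)%N)) v)
      (row i (u k t)).
  by move=> kN t tT; exact: (dcs_u run).
have xP k : (k <= N)%N -> P (x k).
  elim: k => [_|k IH kN]; first by case: (dcs_init run).
  move=> i; rewrite (dcs_x run) //.
  have u0 : row i (u k.+1 0%N) = row i (x (k.+1 - 1)%N) by rewrite (dcs_u0 run).
  have Xx : X i (row i (x (k.+1 - 1)%N)).
    by rewrite subn1 /=; exact: IH (ltnW kN) i.
  exact: (inner_mem Xx u0 (u_argmin k.+1 i kN)).
pose err := 2 * M ^+ 2 / (T0%:R * (T0%:R + 1)).
pose eps k := m%:R *
  (err * (kappa^-1 / 2 + 2 * (T0%:R - 1) / (kappa + k%:R * kappa / 2))).
have agent k i v : (1 <= k <= N)%N -> X i v ->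
    X i (row i (xhat k)) /\
    f i (row i (xhat k)) + dotp (row i (w k)) (row i (xhat k))
      + eta k * bregman (omega i) (gomega i) (row i (x (k - 1)%N))
                  (row i (xhat k))
      + (mu / C + eta k) * bregman (omega i) (gomega i) (row i (x k)) v
    <= f i v + dotp (row i (w k)) v
      + eta k * bregman (omega i) (gomega i) (row i (x (k - 1)%N)) v
      + err * (kappa^-1 / 2 + 2 * (T0%:R - 1) / (kappa + k%:R * kappa / 2)).
  move=> kN Xv.
  have Xx : X i (row i (x (k - 1)%N)).
    by apply: xP; case/andP: kN => _ kN; rewrite (leq_trans (leq_subr _ _) kN).
  have u0 : row i (u k 0%N) = row i (x (k - 1)%N) by rewrite (dcs_u0 run).
  have := inner_loop (@X_convex i) (nu_norm i) (omega_prox i) mu_gt0 C_gt0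
    (@f'_subgradient i) (@f_bounds i) (@quadratic_growth i) Xx (eta_gt0 k kN)
    (betaE' k ^~ kN) u0 (u_argmin k i kN) Xv.
  have -> : T k = T0 by exact: TE.
  move=> /(_ T0_gt0) /=.
  have -> : (\sum_(1 <= t < T0.+1) t%:R)^-1 *:
      (\sum_(1 <= t < T0.+1) t%:R *: row i (u k t)) = row i (xhat k).
    rewrite (dcs_xhat run) // TE // [RHS]linearZ [in RHS]linear_sum /=.
    congr (_^-1 *: _).
      by apply: eq_big_nat => t /andP[t1 _]; rewrite lambdaE.
    by apply: eq_big_nat => t /andP[t1 _]; rewrite lambdaE // linearZ.
  rewrite (dcs_x run kN) TE //.
  have -> : C / (2 * mu) = kappa^-1 / 2.
    by rewrite /kappa; field; rewrite ?mu_neq0 ?C_neq0.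
  have -> : mu / C + eta k = kappa + k%:R * kappa / 2.
    by rewrite etaE // /kappa; field; rewrite ?C_neq0.
  by [].
have xhatP k : (1 <= k <= N)%N -> P (xhat k).
  (* Any comparison point of X_i gives membership; row i of [xs] is one. *)
  by move=> kN i; case: (agent k i _ kN (xs_opt.1.2 i)).
have xhat0 : xhat 0%N = x 0%N by case: (dcs_init run).
have primal_step k z : (1 <= k <= N)%N -> P z ->
    F (xhat k) + dotp (boldL e (xhat k)) (y k)
      + k%:R * kappa / 2 * V (x (k - 1)%N) (xhat k)
      + (k%:R + 2) * kappa / 2 * V (x k) z
    <= F z + dotp (boldL e z) (y k)
      + k%:R * kappa / 2 * V (x (k - 1)%N) z + eps k.
  move=> kN Pz.
  rewrite !dotp_boldL // -(dcs_w run) // !(dotpC _ (w k)) !dotp_rows.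
  have -> : k%:R * kappa / 2 = eta k.
    by rewrite etaE // /kappa; field; rewrite ?C_neq0.
  have -> : (k%:R + 2) * kappa / 2 = mu / C + eta k.
    by rewrite etaE // /kappa; field; rewrite ?C_neq0.
  rewrite /eps mulr_natl -[m in _ *+ m]card_ord -sumr_const.
  rewrite /V /sum_bregman !mulr_sumr -!big_split /=; apply: ler_sum => i _.
  by case: (agent k i _ kN (Pz i)).
have dual_step k : (1 <= k <= N)%N ->
    (k%:R + 1) *: boldL e (xhat k) =
    (4 * ell ^+ 2 / kappa) *: (y k - y (k - 1)%N)
    + ((k%:R + 1) *: boldL e (xhat k - x (k - 1)%N)
       - k%:R *: boldL e (xhat (k - 1)%N - x (k - 1 - 1)%N)).
  move=> kN; have k1 : k%:R + 1 != 0 :> R by rewrite gt_eqF // ltr_wpDl.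
  have -> : (4 * ell ^+ 2 / kappa) *: (y k - y (k - 1)%N) =
      (k%:R + 1) *: boldL e (xtilde k).
    rewrite (dcs_y run) // addrAC subrr add0r scalerA.
    (* If ell = 0 then tau_k = 0 has no true inverse, but L vanishes and so do both sides. *)
    have [ell0|ell_neq0] := eqVneq ell 0.
      have := enorm_boldL e nu_norm (xtilde k); rewrite -/ell ell0 mul0r => L0.
      have -> : boldL e (xtilde k) = 0.
        by apply: enorm_eq0; apply/eqP; rewrite eq_le L0 enorm_ge0.
      by rewrite !scaler0.
    rewrite tauE // -/ell /kappa; congr (_ *: _); field.
    by rewrite ell_neq0 C_neq0 mu_neq0 k1.
  rewrite (dcs_xtilde run) // alphaE // -subnDA.
  rewrite -!boldLZ -!boldLN -!boldLD; congr (boldL e _).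
  set delta := xhat (k - 1)%N - _.
  rewrite scalerDr scalerA mulrCA mulfV // mulr1 (scalerBr _ (xhat k)).
  by rewrite [RHS]addrC addrA !subrK.
pose S : R := N%:R * (N%:R + 3) / 2.
have S_gt0 : 0 < S by rewrite divr_gt0 ?mulr_gt0 ?addr_gt0.
have SE : 2 / (N%:R * (N%:R + 3)) = S^-1 by rewrite /S invf_div.
have xavgE : xavg = S^-1 *: \sum_(1 <= k < N.+1) (k%:R + 1) *: xhat k.
  by rewrite /xavg SE.
have xavgP : P xavg.
  move=> i; have := @convex_set_avg R 'rV[R]_d (X i) (@X_convex i)
    (fun k => k%:R + 1) (fun k => row i (xhat k)) N (ltnW hN) _ _.
  rewrite sum_nat_succ -/S.
  have -> : S^-1 *: (\sum_(1 <= k < N.+1) (k%:R + 1) *: row i (xhat k)) =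
      row i xavg.
    rewrite xavgE [RHS]linearZ [in RHS]linear_sum /=; congr (_ *: _).
    by apply: eq_bigr => k _; rewrite linearZ.
  by apply=> k kN; [rewrite ltr_wpDl|exact: xhatP].
have Pxs : P xs := xs_opt.1.2.
have Lxs : boldL e xs = 0 := xs_opt.1.1.
have VN : 0 <= V (x N) xs.
  by apply: le_trans (V_ge _ _ (xP N (leqnn N)) Pxs); rewrite divr_ge0 ?sqr_ge0.
have coefN : 0 <= (N%:R + 1) * (N%:R + 2) * kappa / 2 * V (x N) xs.
  apply: mulr_ge0 VN; apply: divr_ge0 => //; apply: mulr_ge0 (ltW kappa_gt0).
  by rewrite mulr_ge0 ?addr_ge0.
have Eps : \sum_(1 <= k < N.+1) (k%:R + 1) * eps k <= 2 * kappa * D.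
  apply: inexactness_bound => //; first by rewrite ler1n.
  apply: le_trans T0_ge; rewrite /z0 /kappa le_eqVlt.
  apply/orP; left; apply/eqP.
  by congr (_ * _ * Num.max (_ * _) _); field; rewrite ?mu_neq0 ?C_neq0.
have gap yy := gap_sum nu_norm V_ge kappa_gt0 xP xhatP xhat0 primal_step
  dual_step yy (leqnn N) Pxs.
rewrite SE; split.
  have jensen : S * F xavg <= \sum_(1 <= k < N.+1) (k%:R + 1) * F (xhat k).
    have := @jensen_subgradient R m d F (\matrix_i f' i (row i xavg))
      (fun k => k%:R + 1) xhat N.
    rewrite /= sum_nat_succ -/S -xavgE; apply=> [//|k _|k kN].
      by rewrite addr_ge0.
    rewrite dotp_rows -big_split; apply: ler_sum => i _ /=.
    rewrite rowK linearB; apply: f'_subgradient (xhatP k kN i).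
    exact: xavgP.
  (* At yy = 0, with L xs = 0, the gap is the objective difference. The cross-term bound at index N
     absorbs the boundary term into the squares of delta_N and y^N. *)
  have {gap} := gap 0; have := cross_term e nu_norm (xhat N - x (N - 1)%N)
    (0 - y N) kappa_gt0 (ltnW hN).
  rewrite -/ell !sub0r !(dotpNl (y _)) !(dotpNr (y _)) !opprK.
  under eq_big_nat => k kN do rewrite Lxs dotp0l dotp0r addr0 subr0 mulrBr.
  rewrite sumrB -mulr_suml sum_nat_succ -/S => cross gap.
  have main : S * (F xavg - F xs) <= kappa * V (x 0%N) xs
      + 4 * ell ^+ 2 / kappa / 2 * dotp (y 0%N) (y 0%N) + 2 * kappa * D.
    by rewrite mulrBr; lra.
  rewrite -(ler_pM2l S_gt0) mulrA divff ?gt_eqF // mul1r sqr_enorm.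
  apply: le_trans main _; rewrite le_eqVlt; apply/orP; left; apply/eqP.
  by rewrite /kappa; field; rewrite ?mu_neq0 ?C_neq0.
(* Each summand is nonnegative by the saddle inequality in x, again with L xs = 0. *)
have gap_ge0 : 0 <= \sum_(1 <= k < N.+1) (k%:R + 1) *
    (F (xhat k) + dotp (boldL e (xhat k)) ys - F xs - dotp (boldL e xs) (y k)).
  rewrite big_nat; apply: sumr_ge0 => k kN.
  apply: mulr_ge0; first by rewrite addr_ge0.
  have /andP[_] := xs_ys_saddle.2 _ ys (xhatP k kN).
  by rewrite /lagrangian Lxs !dotp0l -/F; lra.
have {}gap := le_trans gap_ge0 (gap ys).
set delta := xhat N - x (N - 1)%N in gap.
have := dual_sum xhat0 dual_step (leqnn N); rewrite -/ell -/delta => dual.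
set a := enorm (ys - y N); set r := enorm (ys - y 0%N); set b := pnorm nu delta.
have delta_le : enorm (boldL e delta) <= ell * b by exact: enorm_boldL.
have feas := @feasibility_bound R ell kappa (V (x 0%N) xs) D a b r N ell_ge0
  kappa_gt0 _ D_gt0 (enorm_ge0 _) (pnorm_ge0 _ _) (enorm_ge0 _) hN _.
have Lxavg : boldL e xavg =
    S^-1 *: ((4 * ell ^+ 2 / kappa) *: (y N - y 0%N)
             + (N%:R + 1) *: boldL e delta).
  rewrite xavgE boldLZ boldL_sum -dual; congr (_ *: _).
  by apply: eq_bigr => k _; rewrite boldLZ.
have c_ge0 : 0 <= 4 * ell ^+ 2 / kappa.
  by apply: divr_ge0 (ltW kappa_gt0); rewrite mulr_ge0 ?sqr_ge0.
have N1_ge0 : 0 <= N%:R + 1 :> R by rewrite addr_ge0.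
rewrite Lxavg enormZ gtr0_norm ?invr_gt0 //.
have -> : 8 * ell / (N%:R * (N%:R + 3)) = S^-1 * (4 * ell).
  by rewrite -SE; ring.
rewrite -[leRHS]mulrA ler_pM2l ?invr_gt0 //.
apply: (@le_trans _ _
  (4 * ell ^+ 2 / kappa * (r + a) + (N%:R + 1) * (ell * b))).
  apply: le_trans (enormD _ _) _; rewrite !enormZ !ger0_norm //.
  apply: lerD; apply: ler_wpM2l => //.
  (* Passing through [ys] bounds |y^N - y^0| by r + a. *)
  have -> : y N - y 0%N = (ys - y 0%N) - (ys - y N).
    by rewrite opprB [RHS]addrC subrKA.
  by apply: le_trans (enormD _ _) _; rewrite enormN.
have -> : 7 * ell * C / mu * r = 7 * ell * r / kappa.
  by rewrite /kappa; field; rewrite ?mu_neq0 ?C_neq0.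
apply: feas.
  by apply: le_trans (V_ge _ _ (xP 0%N _) Pxs); rewrite ?divr_ge0 ?sqr_ge0.
(* The boundary term is kept here: it supplies the product a b of the quadratic form. *)
have cs : dotp (boldL e delta) (ys - y N) <= ell * b * a.
  apply: le_trans (dotp_le_enorm _ _) _; rewrite ler_wpM2r //; exact: enorm_ge0.
have := ler_wpM2l N1_ge0 cs; move: gap.
by rewrite -/ell -!sqr_enorm -/a -/r -/b; lra.
Qed.
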